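(* Let $\alpha\in\mathbb{R}$, let $e_{l_km_k}=\mathrm{sgrad}(Y_{l_km_k})$ and $a_k\in\mathbb{R}$ for $k=1,2,3,4$. The curvature $\hat R$ of $\hat{\mathfrak g}$ is given by $$\ll \hat R\big((e_{l_1m_1},a_1),(e_{l_2m_2},a_2)\big)(e_{l_3m_3},a_3),(e_{l_4m_4},a_4)\gg_{\hat{\mathfrak g}}$$ $$=\sum_{l,m}(-1)^m(\alpha^2+l(l+1))\Big[\Gamma^{l\,m}_{l_1m_1a_1\,l_3m_3a_3}\Gamma^{l\,-m}_{l_2m_2a_2\,l_4m_4a_4}-\Gamma^{l\,m}_{l_2m_2a_2\,l_3m_3a_3}\Gamma^{l\,-m}_{l_1m_1a_1\,l_4m_4a_4}$$ $$\qquad+G^{l\,m}_{l_1m_1\,l_2m_2}\Big(G^{l\,-m}_{l_3m_3\,l_4m_4}k^l_{l_3l_4}+\tfrac12\big(a_4D^{l\,-m}_{1\,0\,l_3m_3}-a_3D^{l\,-m}_{1\,0\,l_4m_4}\big)\Big)\Big]$$ $$-\frac{m_1m_2}{4}(-1)^{m_1+m_2}\Big[\delta^{l_1}_{l_3}\delta^{m_1}_{-m_3}\delta^{l_2}_{l_4}\delta^{m_2}_{-m_4}-\delta^{l_2}_{l_3}\delta^{m_2}_{-m_3}\delta^{l_1}_{l_4}\delta^{m_1}_{-m_4}\Big]-\frac{m_1m_3}{2}(-1)^{m_1+m_3}\delta^{l_1}_{l_2}\delta^{m_1}_{-m_2}\delta^{l_3}_{l_4}\delta^{m_3}_{-m_4},$$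 where $$k^l_{l_3l_4}=\frac12\,\frac{-\alpha^2+l(l+1)-l_3(l_3+1)-l_4(l_4+1)}{\alpha^2+l(l+1)}.$$
   Context: Use coordinates $(\lambda,\mu)$, $0\le\lambda\le2\pi$, $-1\le\mu\le1$, on the unit sphere $\mathbb S^2$ ($\mu$ = height, $\lambda$ = longitude). Put $\{f,g\}=\frac{\partial f}{\partial\lambda}\frac{\partial g}{\partial\mu}-\frac{\partial f}{\partial\mu}\frac{\partial g}{\partial\lambda}$ and $\langle f,g\rangle=\int_{-1}^1\int_0^{2\pi}fg\,d\lambda\,d\mu$ (complex bilinear, no conjugation). $\Delta$ is the Laplace–Beltrami operator of $\mathbb S^2$, and $\Delta_\theta=\alpha^2-\Delta$. $\mathfrak g$ is the Lie algebra of elements written $\mathrm{sgrad} f$, where $f$ is a function on $\mathbb S^2$ and $f\mapsto\mathrm{sgrad} f$ is a linear isomorphism (functions are taken modulo constants if $\alpha=0$), with $[\mathrm{sgrad} f,\mathrm{sgrad} g]=\mathrm{sgrad}\{f,g\}$ and $\ll\mathrm{sgrad} f,\mathrm{sgrad} g\gg_{\mathfrak g}=\langle\Delta_\theta f,g\rangle$; everything is extended complex-bilinearly to complex-valued functions. The central extension $\hat{\mathfrak g}=\mathfrak g\ltimes_\Omega\mathbb R$ has bracket $[(u,a),(v,b)]=([u,v],\Omega(u,v))$ and inner product $\ll(u,a),(v,b)\gg_{\hat{\mathfrak g}}=\ll u,v\gg_{\mathfrak g}+ab$, where $\Omega(\mathrm{sgrad} f,\mathrm{sgrad} g)=\langle\mu,\{f,g\}\rangle$.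 The connection $\hat\nabla$ on $\hat{\mathfrak g}$ is the bilinear map determined by $2\ll\hat\nabla_XY,Z\gg=\ll[X,Y],Z\gg-\ll[Y,Z],X\gg+\ll[Z,X],Y\gg$, and $\hat R(X,Y)Z=\hat\nabla_X\hat\nabla_YZ-\hat\nabla_Y\hat\nabla_XZ-\hat\nabla_{[X,Y]}Z$. $Y_{lm}$, $|m|\le l$, are the standard complex spherical harmonics on $\mathbb S^2$ with Condon–Shortley phase: $\Delta Y_{lm}=-l(l+1)Y_{lm}$, $\overline{Y_{lm}}=(-1)^mY_{l\,-m}$, $\langle Y_{l_1m_1},Y_{l_2m_2}\rangle=(-1)^{m_1}\delta^{l_1}_{l_2}\delta^{m_1}_{-m_2}$, $Y_{10}=\sqrt{3/4\pi}\,\mu$; i.e. $Y_{lm}=C_l^mP_l^{|m|}(\mu)e^{im\lambda}$ with $P_l^{|m|}(\mu)=\frac{(1-\mu^2)^{|m|/2}}{2^ll!}\frac{d^{l+|m|}}{d\mu^{l+|m|}}(\mu^2-1)^l$, $C_l^m=\epsilon_m\sqrt{\frac{2l+1}{4\pi}\frac{(l-|m|)!}{(l+|m|)!}}$, $\epsilon_m=(-1)^m$ for $m\ge0$ and $\epsilon_m=1$ for $m<0$. All degrees $l$ are $\ge0$ if $\alpha\ne0$ and $\ge1$ if $\alpha=0$. Structure constants are defined by $\{Y_{l_1m_1},Y_{l_2m_2}\}=\sum_{l_3,m_3}G^{l_3m_3}_{l_1m_1\,l_2m_2}Y_{l_3m_3}$ (a finite sum). Set $$D^{l_3m_3}_{1\,0\,l_2m_2}=\sqrt{\tfrac{4\pi}{3}}\,\frac{G^{l_3m_3}_{1\,0\,l_2m_2}}{\alpha^2+l_3(l_3+1)},\qquad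 d^{l_3}_{l_1l_2}=\frac12\,\frac{\alpha^2+l_3(l_3+1)-l_1(l_1+1)+l_2(l_2+1)}{\alpha^2+l_3(l_3+1)},$$ $$\Gamma^{l_3m_3}_{l_1m_1a_1\,l_2m_2a_2}=d^{l_3}_{l_1l_2}G^{l_3m_3}_{l_1m_1\,l_2m_2}-\tfrac12\big(a_1D^{l_3m_3}_{1\,0\,l_2m_2}+a_2D^{l_3m_3}_{1\,0\,l_1m_1}\big).$$ The sum $\sum_{l,m}$ runs over all admissible $l$ and $|m|\le l$. *)

(* Defs.v *)
From Stdlib Require Import Reals ZArith.
From Coquelicot Require Import Coquelicot.
Open Scope R_scope.

(* A complex function on S^2 is represented by its coordinate expression
    [f : R -> R -> C], [f lambda mu].  Only its values for -1 < mu < 1 carry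
    meaning: the two poles, where the coordinates degenerate, are left out,
    which loses nothing for continuous functions on S^2. *)

Definition sphere_pt (lambda mu : R) : R * R * R :=
  (sqrt (1 - mu ^ 2) * cos lambda, sqrt (1 - mu ^ 2) * sin lambda, mu).

Definition pd1 (F : R * R * R -> R) : R * R * R -> R :=
  fun p => let '(x, y, z) := p in Derive (fun t => F (t, y, z)) x.
Definition pd2 (F : R * R * R -> R) : R * R * R -> R :=
  fun p => let '(x, y, z) := p in Derive (fun t => F (x, t, z)) y.
Definition pd3 (F : R * R * R -> R) : R * R * R -> R :=
  fun p => let '(x, y, z) := p in Derive (fun t => F (x, y, t)) z.

Fixpoint times_differentiable (k : nat) (F : R * R * R -> R) : Prop :=
  match k with
  | O => True
  | S k' =>
      (forall p : R * R * R, ex_filterdiff (K := R_AbsRing) F (locally p)) /\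
      times_differentiable k' (pd1 F) /\
      times_differentiable k' (pd2 F) /\
      times_differentiable k' (pd3 F)
  end.

(* Smooth functions on S^2 are the restrictions of smooth functions on R^3;
   [F1] and [F2] extend the real and the imaginary part.  In particular
   [f] is 2 PI-periodic in lambda and extends smoothly over the poles. *)
Definition smooth_S2 (f : R -> R -> C) : Prop :=
  exists F1 F2 : R * R * R -> R,
    (forall k, times_differentiable k F1) /\
    (forall k, times_differentiable k F2) /\
    forall lambda mu, -1 < mu < 1 ->
      f lambda mu = (F1 (sphere_pt lambda mu), F2 (sphere_pt lambda mu)).

Definition eq_S2 (f g : R -> R -> C) : Prop :=
  forall lambda mu, -1 < mu < 1 -> f lambda mu = g lambda mu.

Definition CDer (u : R -> C) (t : R) : C :=
  (Derive (fun s => Re (u s)) t, Derive (fun s => Im (u s)) t).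

Definition d_lambda (f : R -> R -> C) : R -> R -> C :=
  fun lambda mu => CDer (fun t => f t mu) lambda.
Definition d_mu (f : R -> R -> C) : R -> R -> C :=
  fun lambda mu => CDer (fun t => f lambda t) mu.

Definition poisson (f g : R -> R -> C) : R -> R -> C :=
  fun lambda mu =>
    (d_lambda f lambda mu * d_mu g lambda mu
     - d_mu f lambda mu * d_lambda g lambda mu)%C.

(* Laplace-Beltrami operator of the round metric
   dmu^2 / (1 - mu^2) + (1 - mu^2) dlambda^2. *)
Definition laplacian (f : R -> R -> C) : R -> R -> C :=
  fun lambda mu =>
    (d_mu (fun l u => RtoC (1 - u ^ 2) * d_mu f l u) lambda mu
     + RtoC (/ (1 - mu ^ 2)) * d_lambda (d_lambda f) lambda mu)%C.

Definition laplacian_theta (alpha : R) (f : R -> R -> C) : R -> R -> C :=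
  fun lambda mu => (RtoC (alpha ^ 2) * f lambda mu - laplacian f lambda mu)%C.

Definition pairing (f g : R -> R -> C) : C :=
  RInt (V := C_R_CompleteNormedModule)
    (fun mu => RInt (V := C_R_CompleteNormedModule)
       (fun lambda => (f lambda mu * g lambda mu)%C) 0 (2 * PI))
    (-1) 1.

Definition height : R -> R -> C := fun _ mu => RtoC mu.

(* [g] is the complexified Lie algebra; bracket, inner product and cocycle are
   extended complex-bilinearly.  The elements of [g] are the sgrad f for f smooth on S^2; f |-> sgrad f is
   linear and onto, and injective (up to constants when alpha = 0).  Bracket,
   inner product and cocycle are given on these elements by their defining
   formulas.  Values of [sg_sgrad] on non-smooth arguments are irrelevant. *)
Record sgrad_algebra (alpha : R) (g : ModuleSpace C_Ring) := SgradAlgebra {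
  sg_sgrad : (R -> R -> C) -> g;
  sg_br : g -> g -> g;
  sg_ip : g -> g -> C;
  sg_Omega : g -> g -> C;
  sg_sgrad_plus : forall f h, smooth_S2 f -> smooth_S2 h ->
    sg_sgrad (fun l u => (f l u + h l u)%C) = plus (sg_sgrad f) (sg_sgrad h);
  sg_sgrad_scal : forall (c : C) f, smooth_S2 f ->
    sg_sgrad (fun l u => (c * f l u)%C) = scal (c : C_Ring) (sg_sgrad f);
  sg_sgrad_onto : forall X : g, exists f, smooth_S2 f /\ sg_sgrad f = X;
  sg_sgrad_inj : forall f h, smooth_S2 f -> smooth_S2 h ->
    (sg_sgrad f = sg_sgrad h <->
     (alpha <> 0 /\ eq_S2 f h) \/
     (alpha = 0 /\ exists c : C, eq_S2 f (fun l u => (h l u + c)%C)));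
  sg_brE : forall f h, smooth_S2 f -> smooth_S2 h ->
    sg_br (sg_sgrad f) (sg_sgrad h) = sg_sgrad (poisson f h);
  sg_ipE : forall f h, smooth_S2 f -> smooth_S2 h ->
    sg_ip (sg_sgrad f) (sg_sgrad h) = pairing (laplacian_theta alpha f) h;
  sg_OmegaE : forall f h, smooth_S2 f -> smooth_S2 h ->
    sg_Omega (sg_sgrad f) (sg_sgrad h) = pairing height (poisson f h)
}.

Arguments sg_sgrad {alpha g} _ _.
Arguments sg_br {alpha g} _ _ _.
Arguments sg_ip {alpha g} _ _ _.
Arguments sg_Omega {alpha g} _ _ _.

Definition hat (g : ModuleSpace C_Ring) : ModuleSpace C_Ring :=
  prod_ModuleSpace C_Ring g (Ring_ModuleSpace C_Ring).

Definition hat_br {alpha g} (A : sgrad_algebra alpha g) (X Y : hat g) : hat g :=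
  (sg_br A (fst X) (fst Y), sg_Omega A (fst X) (fst Y)).

Definition hat_ip {alpha g} (A : sgrad_algebra alpha g) (X Y : hat g) : C :=
  (sg_ip A (fst X) (fst Y) + (snd X : C) * (snd Y : C))%C.

Definition bilinear_map {V : ModuleSpace C_Ring} (B : V -> V -> V) : Prop :=
  (forall X X' Y, B (plus X X') Y = plus (B X Y) (B X' Y)) /\
  (forall X Y Y', B X (plus Y Y') = plus (B X Y) (B X Y')) /\
  (forall (c : C_Ring) X Y, B (scal c X) Y = scal c (B X Y)) /\
  (forall (c : C_Ring) X Y, B X (scal c Y) = scal c (B X Y)).

Definition is_connection {alpha g} (A : sgrad_algebra alpha g)
    (nabla : hat g -> hat g -> hat g) : Prop :=
  bilinear_map nabla /\
  forall X Y Z : hat g,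
    (RtoC 2 * hat_ip A (nabla X Y) Z)%C =
    (hat_ip A (hat_br A X Y) Z - hat_ip A (hat_br A Y Z) X
     + hat_ip A (hat_br A Z X) Y)%C.

Definition hat_curvature {alpha g} (A : sgrad_algebra alpha g)
    (nabla : hat g -> hat g -> hat g) (X Y Z : hat g) : hat g :=
  minus (minus (nabla X (nabla Y Z)) (nabla Y (nabla X Z)))
        (nabla (hat_br A X Y) Z).

Definition legendre (l k : nat) (mu : R) : R :=
  sqrt (1 - mu ^ 2) ^ k / (2 ^ l * INR (fact l))
  * Derive_n (fun t => (t ^ 2 - 1) ^ l) (l + k) mu.

Definition harmonic_norm (l : nat) (m : Z) : R :=
  (if Z.leb 0 m then powerRZ (-1) m else 1)
  * sqrt ((2 * INR l + 1) / (4 * PI)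
          * (INR (fact (l - Z.abs_nat m)) / INR (fact (l + Z.abs_nat m)))).

Definition Ylm (l : nat) (m : Z) : R -> R -> C :=
  fun lambda mu =>
    (RtoC (harmonic_norm l m * legendre l (Z.abs_nat m) mu)
     * (cos (IZR m * lambda), sin (IZR m * lambda)))%C.

Definition lmin (alpha : R) : nat := if Req_EM_T alpha 0 then 1%nat else 0%nat.

Definition admissible (alpha : R) (l : nat) (m : Z) : Prop :=
  (lmin alpha <= l)%nat /\ (Z.abs m <= Z.of_nat l)%Z.

Definition CSeries (a : nat -> C) : C :=
  (Series (fun n => Re (a n)), Series (fun n => Im (a n))).

(* Sum over all admissible (l, m); it is only applied to families that vanish
   for l large, for which the series is a finite sum. *)
Definition sum_lm (alpha : R) (F : nat -> Z -> C) : C :=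
  CSeries (fun k =>
    let l := (lmin alpha + k)%nat in
    sum_n (G := C_AbelianMonoid)
      (fun j => F l (Z.of_nat j - Z.of_nat l)%Z) (2 * l)).

(* [G l1 m1 l2 m2 l3 m3] is G^{l3 m3}_{l1 m1 l2 m2}. *)
Definition is_structure_constants (alpha : R)
    (G : nat -> Z -> nat -> Z -> nat -> Z -> C) : Prop :=
  forall l1 m1 l2 m2, admissible alpha l1 m1 -> admissible alpha l2 m2 ->
    (exists L : nat, forall l3 m3, admissible alpha l3 m3 -> (L < l3)%nat ->
       G l1 m1 l2 m2 l3 m3 = RtoC 0) /\
    eq_S2 (poisson (Ylm l1 m1) (Ylm l2 m2))
      (fun lambda mu => sum_lm alpha (fun l3 m3 =>
         (G l1 m1 l2 m2 l3 m3 * Ylm l3 m3 lambda mu)%C)).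

Definition lap (l : nat) : R := INR l * (INR l + 1).

Definition Dcoef (alpha : R) (G : nat -> Z -> nat -> Z -> nat -> Z -> C)
    (l2 : nat) (m2 : Z) (l3 : nat) (m3 : Z) : C :=
  (RtoC (sqrt (4 * PI / 3)) * G 1%nat 0%Z l2 m2 l3 m3
   / RtoC (alpha ^ 2 + lap l3))%C.

Definition dcoef (alpha : R) (l1 l2 l3 : nat) : R :=
  / 2 * ((alpha ^ 2 + lap l3 - lap l1 + lap l2) / (alpha ^ 2 + lap l3)).

Definition kcoef (alpha : R) (l3 l4 l : nat) : R :=
  / 2 * ((- alpha ^ 2 + lap l - lap l3 - lap l4) / (alpha ^ 2 + lap l)).

Definition Gammacoef (alpha : R) (G : nat -> Z -> nat -> Z -> nat -> Z -> C)
    (l1 : nat) (m1 : Z) (a1 : R) (l2 : nat) (m2 : Z) (a2 : R)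
    (l3 : nat) (m3 : Z) : C :=
  (RtoC (dcoef alpha l1 l2 l3) * G l1 m1 l2 m2 l3 m3
   - RtoC (/ 2) * (RtoC a1 * Dcoef alpha G l2 m2 l3 m3
                   + RtoC a2 * Dcoef alpha G l1 m1 l3 m3))%C.

Definition delta_l (i j : nat) : C := RtoC (if Nat.eqb i j then 1 else 0).
Definition delta_m (i j : Z) : C := RtoC (if Z.eqb i j then 1 else 0).
Definition sgn (m : Z) : C := RtoC (powerRZ (-1) m).

Definition e_hat {alpha g} (A : sgrad_algebra alpha g)
    (l : nat) (m : Z) (a : R) : hat g :=
  (sg_sgrad A (Ylm l m), RtoC a).

(* Main.v *)
Require Import Defs.
From Stdlib Require Import Reals ZArith Lra Lia FunctionalExtensionality.
From Coquelicot Require Import Coquelicot.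
Open Scope R_scope.

(** Write (f, h) for [pairing f h] and lam_l for alpha^2 + l(l+1).  Everything
    follows from three facts about smooth functions on the sphere:

    - invariance of the pairing, ({f, g}, h) = (f, {g, h});
    - symmetry of the Laplacian, (Delta f, h) = (f, Delta h);
    - the relations Delta Y_{lm} = -l(l+1) Y_{lm} and
      (Y_{lm}, Y_{l'm'}) = (-1)^m delta_{ll'} delta_{m,-m'}.

    The first two are instances of one divergence theorem
    ([sphere_int_divergence]).  If F extends f to space, then d/dlambda and
    (1 - mu^2) d/dmu act on f through the polynomial vector fields [rot] and
    [mer], which are regular at the poles.  When (1 - mu^2) N is [mer] K minus
    [rot] J and K vanishes at the poles, integrating over lambda removes the
    [rot] term and integrating over mu leaves boundary values of K, which are 0.
    The orthogonality relations for different degrees, respectively orders, follow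
    from the symmetry of Delta, respectively from the invariance applied to
    {mu, Y_{lm}} = - i m Y_{lm}; only the norms need a computation with Legendre
    polynomials.

    By the Koszul formula, nabla_{(e_1,a_1)} (e_2,a_2) = (sgrad f, c) where
    (Y_{lm}, f) = (-1)^m Gamma^{l,-m}_{12} and 2 c = Omega(e_1, e_2)
    ([nabla_e_coefficients]).  Here f is only known to be some smooth function,
    and no expansion of it is needed: in << nabla_{e_1} (sgrad f, c), e_4 >>
    invariance and symmetry move every derivative off f, so that f appears only
    paired with brackets of two harmonics, which are finite sums of harmonics.  The
    result is minus the sum of lam_l Gamma^{lm}_{14} (Y_{lm}, f), minus
    c Omega(e_1, e_4) / 2 ([hat_ip_nabla_e]).  In particular neither the
    nondegeneracy of the inner product nor the completeness of the harmonics is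
    used.  The term nabla_{[e_1,e_2]} e_3 is expanded in the same way
    ([hat_ip_nabla_br]), and the products of values of Omega give the Kronecker
    deltas, since Omega(e_1, e_2) = - i m_1 (Y_1, Y_2). *)

(** * Smooth functions on R^3 *)

Definition differentiable3 (F : R * R * R -> R) : Prop :=
  forall p : R * R * R, ex_filterdiff (K := R_AbsRing) F (locally p).

(** Infinitely differentiable functions on R^3. *)
Definition smooth3 (F : R * R * R -> R) : Prop :=
  forall k, times_differentiable k F.

Lemma smooth3_differentiable F : smooth3 F -> differentiable3 F.
Proof. intros H; exact (proj1 (H 1%nat)). Qed.

Lemma smooth3_pd F : smooth3 F ->
  smooth3 (pd1 F) /\ smooth3 (pd2 F) /\ smooth3 (pd3 F).
Proof.
  intros H; repeat split; intros k; destruct (H (S k)) as (_ & H1 & H2 & H3);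
    assumption.
Qed.

Lemma filterdiff_pair {U V W : NormedModule R_AbsRing} (f : U -> V) (g : U -> W)
    (x : U) (lf : U -> V) (lg : U -> W) :
  filterdiff f (locally x) lf -> filterdiff g (locally x) lg ->
  filterdiff (fun t => (f t, g t)) (locally x) (fun t => (lf t, lg t)).
Proof.
  intros Hf Hg.
  apply (filterdiff_comp'_2 f g (fun a b => (a, b)) x lf lg (fun a b => (a, b)));
    try assumption.
  apply filterdiff_ext with (fun t : V * W => t); [now intros [a b] |].
  apply filterdiff_ext_lin with (fun t : V * W => t); [| now intros [a b]].
  apply filterdiff_id.
Qed.

(** Derivative along a curve, in terms of the differential [l]. *)
Lemma is_derive_path_lin (F l : R * R * R -> R) (x y z : R -> R) (t dx dy dz : R) :
  filterdiff (K := R_AbsRing) F (locally (x t, y t, z t)) l ->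
  is_derive x t dx -> is_derive y t dy -> is_derive z t dz ->
  is_derive (fun s : R => F (x s, y s, z s)) t (l (dx, dy, dz)).
Proof.
  intros HF Hx Hy Hz.
  assert (Hl : is_linear l) by apply HF.
  apply filterdiff_ext_lin with
    (fun s : R => l (scal s dx, scal s dy, scal s dz)).
  - apply (filterdiff_comp' (K := R_AbsRing) (fun s : R => (x s, y s, z s)) F t
             (fun s : R => (scal s dx, scal s dy, scal s dz)) l); [| exact HF].
    apply (filterdiff_pair (fun s : R => (x s, y s)) z); [| exact Hz].
    now apply (filterdiff_pair x y).
  - intros s. now rewrite <- (linear_scal l Hl).
Qed.

Lemma is_derive_idR (x : R) : is_derive (fun t : R => t) x 1.
Proof. auto_derive; trivial. Qed.

Lemma is_derive_cstR (c x : R) : is_derive (fun _ : R => c) x 0.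
Proof. auto_derive; trivial. Qed.

(** The chain rule along a curve, in terms of the partial derivatives. *)
Lemma is_derive_path (F : R * R * R -> R) (x y z : R -> R) (t dx dy dz : R) :
  differentiable3 F ->
  is_derive x t dx -> is_derive y t dy -> is_derive z t dz ->
  is_derive (fun s : R => F (x s, y s, z s)) t
    (pd1 F (x t, y t, z t) * dx + pd2 F (x t, y t, z t) * dy
     + pd3 F (x t, y t, z t) * dz).
Proof.
  intros HF Hx Hy Hz.
  destruct (HF (x t, y t, z t)) as [l Hl].
  assert (Hlin : is_linear l) by apply Hl.
  assert (E1 : pd1 F (x t, y t, z t) = l (1, 0, 0)).
  { apply is_derive_unique.
    apply (is_derive_path_lin F l (fun s => s) (fun _ => y t) (fun _ => z t) (x t) 1 0 0);
      [exact Hl | apply is_derive_idR | apply is_derive_cstR | apply is_derive_cstR]. }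
  assert (E2 : pd2 F (x t, y t, z t) = l (0, 1, 0)).
  { apply is_derive_unique.
    apply (is_derive_path_lin F l (fun _ => x t) (fun s => s) (fun _ => z t) (y t) 0 1 0);
      [exact Hl | apply is_derive_cstR | apply is_derive_idR | apply is_derive_cstR]. }
  assert (E3 : pd3 F (x t, y t, z t) = l (0, 0, 1)).
  { apply is_derive_unique.
    apply (is_derive_path_lin F l (fun _ => x t) (fun _ => y t) (fun s => s) (z t) 0 0 1);
      [exact Hl | apply is_derive_cstR | apply is_derive_cstR | apply is_derive_idR]. }
  rewrite E1, E2, E3.
  replace (l (1, 0, 0) * dx + l (0, 1, 0) * dy + l (0, 0, 1) * dz)
    with (l (dx, dy, dz)).
  - now apply is_derive_path_lin.
  - replace (dx, dy, dz) with
      (plus (plus (scal (dx : R_AbsRing) (1, 0, 0)) (scal (dy : R_AbsRing) (0, 1, 0)))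
        (scal (dz : R_AbsRing) (0, 0, 1) : R * R * R)).
    + rewrite !(linear_plus l Hlin), !(linear_scal l Hlin).
      unfold plus, scal; simpl. unfold mult; simpl. ring.
    + unfold plus, scal; simpl. unfold prod_plus, prod_scal; simpl.
      unfold plus, scal; simpl. unfold prod_plus, prod_scal; simpl.
      unfold plus, scal, mult; simpl. unfold mult; simpl.
      f_equal; [f_equal |]; ring.
Qed.

Lemma is_derive_pd1 F x y z : differentiable3 F ->
  is_derive (fun t => F (t, y, z)) x (pd1 F (x, y, z)).
Proof.
  intros HF.
  replace (pd1 F (x, y, z)) with
    (pd1 F (x, y, z) * 1 + pd2 F (x, y, z) * 0 + pd3 F (x, y, z) * 0) by ring.
  apply (is_derive_path F (fun t => t) (fun _ => y) (fun _ => z)); trivial;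
    first [apply is_derive_idR | apply is_derive_cstR].
Qed.

Lemma is_derive_pd2 F x y z : differentiable3 F ->
  is_derive (fun t => F (x, t, z)) y (pd2 F (x, y, z)).
Proof.
  intros HF.
  replace (pd2 F (x, y, z)) with
    (pd1 F (x, y, z) * 0 + pd2 F (x, y, z) * 1 + pd3 F (x, y, z) * 0) by ring.
  apply (is_derive_path F (fun _ => x) (fun t => t) (fun _ => z)); trivial;
    first [apply is_derive_idR | apply is_derive_cstR].
Qed.

Lemma is_derive_pd3 F x y z : differentiable3 F ->
  is_derive (fun t => F (x, y, t)) z (pd3 F (x, y, z)).
Proof.
  intros HF.
  replace (pd3 F (x, y, z)) with
    (pd1 F (x, y, z) * 0 + pd2 F (x, y, z) * 0 + pd3 F (x, y, z) * 1) by ring.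
  apply (is_derive_path F (fun _ => x) (fun _ => y) (fun t => t)); trivial;
    first [apply is_derive_idR | apply is_derive_cstR].
Qed.

(** Reduces an equation between functions whose left side is a partial
    derivative to the computation of an ordinary derivative. *)
Ltac pd_ext :=
  apply functional_extensionality; intros [[?x ?y] ?z]; cbn -[Rmult Rplus];
  apply is_derive_unique.

(** Pointwise operations and coordinate functions.  They are named so that
    derivatives of composite expressions can be computed by rewriting. *)
Definition fadd (F H : R * R * R -> R) := fun p => F p + H p.
Definition fmul (F H : R * R * R -> R) := fun p => F p * H p.
Definition fcst (c : R) : R * R * R -> R := fun _ => c.
Definition cx (p : R * R * R) : R := fst (fst p).
Definition cy (p : R * R * R) : R := snd (fst p).
Definition cz (p : R * R * R) : R := snd p.

Lemma differentiable3_add F H : differentiable3 F -> differentiable3 H ->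
  differentiable3 (fadd F H).
Proof.
  intros HF HH p. destruct (HF p) as [l Hl], (HH p) as [m Hm].
  eexists. apply (filterdiff_plus_fct (K := R_AbsRing) F H); eassumption.
Qed.

Lemma differentiable3_mul F H : differentiable3 F -> differentiable3 H ->
  differentiable3 (fmul F H).
Proof.
  intros HF HH p. destruct (HF p) as [l Hl], (HH p) as [m Hm].
  eexists. apply (filterdiff_mult_fct (K := R_AbsRing) F H);
    [exact Rmult_comm | eassumption | eassumption].
Qed.

Lemma pd_add F H : differentiable3 F -> differentiable3 H ->
  pd1 (fadd F H) = fadd (pd1 F) (pd1 H) /\
  pd2 (fadd F H) = fadd (pd2 F) (pd2 H) /\
  pd3 (fadd F H) = fadd (pd3 F) (pd3 H).
Proof.
  intros HF HH; repeat split; pd_ext.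
  - apply (is_derive_plus (fun t => F (t, y, z)) (fun t => H (t, y, z)));
      now apply is_derive_pd1.
  - apply (is_derive_plus (fun t => F (x, t, z)) (fun t => H (x, t, z)));
      now apply is_derive_pd2.
  - apply (is_derive_plus (fun t => F (x, y, t)) (fun t => H (x, y, t)));
      now apply is_derive_pd3.
Qed.

Lemma pd_mul F H : differentiable3 F -> differentiable3 H ->
  pd1 (fmul F H) = fadd (fmul (pd1 F) H) (fmul F (pd1 H)) /\
  pd2 (fmul F H) = fadd (fmul (pd2 F) H) (fmul F (pd2 H)) /\
  pd3 (fmul F H) = fadd (fmul (pd3 F) H) (fmul F (pd3 H)).
Proof.
  intros HF HH; repeat split; pd_ext.
  - apply (is_derive_mult (fun t => F (t, y, z)) (fun t => H (t, y, z)));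
      [now apply is_derive_pd1 | now apply is_derive_pd1 | exact Rmult_comm].
  - apply (is_derive_mult (fun t => F (x, t, z)) (fun t => H (x, t, z)));
      [now apply is_derive_pd2 | now apply is_derive_pd2 | exact Rmult_comm].
  - apply (is_derive_mult (fun t => F (x, y, t)) (fun t => H (x, y, t)));
      [now apply is_derive_pd3 | now apply is_derive_pd3 | exact Rmult_comm].
Qed.

Lemma times_differentiable_le k F :
  times_differentiable (S k) F -> times_differentiable k F.
Proof.
  revert F; induction k as [|k IH]; intros F; [exact (fun _ => I) |].
  intros (H & H1 & H2 & H3).
  split; [exact H | repeat split; apply IH; assumption].
Qed.

Lemma times_differentiable_add k F H :
  times_differentiable k F -> times_differentiable k H ->
  times_differentiable k (fadd F H).
Proof.
  revert F H; induction k as [|k IH]; intros F H; [easy |].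
  intros (HF & HF1 & HF2 & HF3) (HH & HH1 & HH2 & HH3).
  destruct (pd_add F H HF HH) as (E1 & E2 & E3).
  split; [now apply differentiable3_add |].
  rewrite E1, E2, E3; repeat split; now apply IH.
Qed.

Lemma times_differentiable_mul k F H :
  times_differentiable k F -> times_differentiable k H ->
  times_differentiable k (fmul F H).
Proof.
  revert F H; induction k as [|k IH]; intros F H; [easy |].
  intros TF TH.
  pose proof (times_differentiable_le k F TF) as TF'.
  pose proof (times_differentiable_le k H TH) as TH'.
  destruct TF as (HF & HF1 & HF2 & HF3), TH as (HH & HH1 & HH2 & HH3).
  destruct (pd_mul F H HF HH) as (E1 & E2 & E3).
  split; [now apply differentiable3_mul |].
  rewrite E1, E2, E3; repeat split; apply times_differentiable_add; now apply IH.
Qed.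

Lemma smooth3_add F H : smooth3 F -> smooth3 H -> smooth3 (fadd F H).
Proof. intros HF HH k; now apply times_differentiable_add. Qed.
Lemma smooth3_mul F H : smooth3 F -> smooth3 H -> smooth3 (fmul F H).
Proof. intros HF HH k; now apply times_differentiable_mul. Qed.

Lemma pd_cst c : pd1 (fcst c) = fcst 0 /\ pd2 (fcst c) = fcst 0 /\ pd3 (fcst c) = fcst 0.
Proof. repeat split; pd_ext; exact (is_derive_cstR _ _). Qed.

Lemma smooth3_cst c : smooth3 (fcst c).
Proof.
  intros k; revert c; induction k as [|k IH]; intros c; [easy |].
  destruct (pd_cst c) as (E1 & E2 & E3).
  split; [| rewrite E1, E2, E3; now repeat split].
  intros p; apply ex_filterdiff_const.
Qed.

Lemma smooth3_intro F : differentiable3 F ->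
  smooth3 (pd1 F) -> smooth3 (pd2 F) -> smooth3 (pd3 F) -> smooth3 F.
Proof. intros H H1 H2 H3 [|k]; [easy | repeat split; auto]. Qed.

Lemma pd_cx : pd1 cx = fcst 1 /\ pd2 cx = fcst 0 /\ pd3 cx = fcst 0.
Proof.
  repeat split; pd_ext; first [exact (is_derive_cstR _ _) | exact (is_derive_idR _)].
Qed.
Lemma pd_cy : pd1 cy = fcst 0 /\ pd2 cy = fcst 1 /\ pd3 cy = fcst 0.
Proof.
  repeat split; pd_ext; first [exact (is_derive_cstR _ _) | exact (is_derive_idR _)].
Qed.
Lemma pd_cz : pd1 cz = fcst 0 /\ pd2 cz = fcst 0 /\ pd3 cz = fcst 1.
Proof.
  repeat split; pd_ext; first [exact (is_derive_cstR _ _) | exact (is_derive_idR _)].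
Qed.

Lemma smooth3_cx : smooth3 cx.
Proof.
  destruct pd_cx as (E1 & E2 & E3).
  apply smooth3_intro; rewrite ?E1, ?E2, ?E3; try apply smooth3_cst.
  intros p; exists cx. apply filterdiff_linear.
  apply (is_linear_comp (fun p : R * R * R => fst p) (fun q : R * R => fst q));
    apply is_linear_fst.
Qed.
Lemma smooth3_cy : smooth3 cy.
Proof.
  destruct pd_cy as (E1 & E2 & E3).
  apply smooth3_intro; rewrite ?E1, ?E2, ?E3; try apply smooth3_cst.
  intros p; exists cy. apply filterdiff_linear.
  apply (is_linear_comp (fun p : R * R * R => fst p) (fun q : R * R => snd q));
    [apply is_linear_fst | apply is_linear_snd].
Qed.
Lemma smooth3_cz : smooth3 cz.
Proof.
  destruct pd_cz as (E1 & E2 & E3).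
  apply smooth3_intro; rewrite ?E1, ?E2, ?E3; try apply smooth3_cst.
  intros p; exists cz. apply filterdiff_linear. apply is_linear_snd.
Qed.

Lemma continuity_2d_comp3 F X Y Z u v : differentiable3 F ->
  continuity_2d_pt X u v -> continuity_2d_pt Y u v -> continuity_2d_pt Z u v ->
  continuity_2d_pt (fun a b => F (X a b, Y a b, Z a b)) u v.
Proof.
  intros HF HX HY HZ.
  apply continuity_2d_pt_filterlim in HX, HY, HZ.
  apply continuity_2d_pt_filterlim; simpl.
  assert (C : continuous F (X u v, Y u v, Z u v))
    by apply (filterdiff_continuous (K := R_AbsRing) F), HF.
  intros P HP. destruct (C P HP) as [e He].
  assert (HX' : locally (u, v) (fun c => ball (X u v) e (X (fst c) (snd c))))
    by exact (HX _ (locally_ball (X u v) e)).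
  assert (HY' : locally (u, v) (fun c => ball (Y u v) e (Y (fst c) (snd c))))
    by exact (HY _ (locally_ball (Y u v) e)).
  assert (HZ' : locally (u, v) (fun c => ball (Z u v) e (Z (fst c) (snd c))))
    by exact (HZ _ (locally_ball (Z u v) e)).
  unfold filtermap.
  generalize (filter_and _ _ (filter_and _ _ HX' HY') HZ').
  apply filter_imp. intros c [[Hc1 Hc2] Hc3]. apply He. now repeat split.
Qed.

(** Mixed partial derivatives commute. *)
Lemma pd_comm F : smooth3 F ->
  pd2 (pd1 F) = pd1 (pd2 F) /\ pd3 (pd1 F) = pd1 (pd3 F) /\ pd3 (pd2 F) = pd2 (pd3 F).
Proof.
  intros HF.
  pose proof (smooth3_pd F HF) as (H1 & H2 & H3).
  pose proof (smooth3_pd _ H1) as (H11 & H12 & H13).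
  pose proof (smooth3_pd _ H2) as (H21 & H22 & H23).
  pose proof (smooth3_pd _ H3) as (H31 & H32 & H33).
  assert (D := fun G (h : smooth3 G) => smooth3_differentiable G h).
  assert (EX1 : forall G x y z, smooth3 G -> ex_derive (fun t => G (t, y, z)) x)
    by (intros; eexists; apply is_derive_pd1; auto).
  assert (EX2 : forall G x y z, smooth3 G -> ex_derive (fun t => G (x, t, z)) y)
    by (intros; eexists; apply is_derive_pd2; auto).
  assert (EX3 : forall G x y z, smooth3 G -> ex_derive (fun t => G (x, y, t)) z)
    by (intros; eexists; apply is_derive_pd3; auto).
  repeat split; apply functional_extensionality; intros [[x y] z]; symmetry.
  - apply (Schwarz (fun u v => F (u, v, z))).
    + apply locally_2d_forall; intros u v; repeat split;
        [now apply EX1 | now apply EX2 | now apply (EX1 (pd2 F)) | now apply (EX2 (pd1 F))].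
    + apply (continuity_2d_comp3 (pd1 (pd2 F)) (fun a _ => a) (fun _ b => b) (fun _ _ => z));
       [auto | apply continuity_2d_pt_id1 | apply continuity_2d_pt_id2 | apply
           continuity_2d_pt_const].
    + apply (continuity_2d_comp3 (pd2 (pd1 F)) (fun a _ => a) (fun _ b => b) (fun _ _ => z));
       [auto | apply continuity_2d_pt_id1 | apply continuity_2d_pt_id2 | apply
           continuity_2d_pt_const].
  - apply (Schwarz (fun u v => F (u, y, v))).
    + apply locally_2d_forall; intros u v; repeat split;
        [now apply EX1 | now apply EX3 | now apply (EX1 (pd3 F)) | now apply (EX3 (pd1 F))].
    + apply (continuity_2d_comp3 (pd1 (pd3 F)) (fun a _ => a) (fun _ _ => y) (fun _ b => b));
       [auto | apply continuity_2d_pt_id1 | apply continuity_2d_pt_const | apply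
           continuity_2d_pt_id2].
    + apply (continuity_2d_comp3 (pd3 (pd1 F)) (fun a _ => a) (fun _ _ => y) (fun _ b => b));
       [auto | apply continuity_2d_pt_id1 | apply continuity_2d_pt_const | apply
           continuity_2d_pt_id2].
  - apply (Schwarz (fun u v => F (x, u, v))).
    + apply locally_2d_forall; intros u v; repeat split;
        [now apply EX2 | now apply EX3 | now apply (EX2 (pd3 F)) | now apply (EX3 (pd2 F))].
    + apply (continuity_2d_comp3 (pd2 (pd3 F)) (fun _ _ => x) (fun a _ => a) (fun _ b => b));
       [auto | apply continuity_2d_pt_const | apply continuity_2d_pt_id1 | apply
           continuity_2d_pt_id2].
    + apply (continuity_2d_comp3 (pd3 (pd2 F)) (fun _ _ => x) (fun a _ => a) (fun _ b => b));
       [auto | apply continuity_2d_pt_const | apply continuity_2d_pt_id1 | apply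
           continuity_2d_pt_id2].
Qed.

(** * Vector fields tangent to the sphere *)

(* Constants are opaque for these hints: otherwise the search unfolds brackets and
   Laplacians into sums and products and does not end in reasonable time. *)
Create HintDb s3 discriminated.
#[local] Hint Constants Opaque : s3.
#[local] Hint Variables Opaque : s3.
#[local] Hint Resolve smooth3_add smooth3_mul smooth3_cst smooth3_cx smooth3_cy smooth3_cz
  smooth3_differentiable : s3.

Lemma smooth3_pd1 F : smooth3 F -> smooth3 (pd1 F).
Proof. intros H; apply (smooth3_pd F H). Qed.
Lemma smooth3_pd2 F : smooth3 F -> smooth3 (pd2 F).
Proof. intros H; apply (smooth3_pd F H). Qed.
Lemma smooth3_pd3 F : smooth3 F -> smooth3 (pd3 F).
Proof. intros H; apply (smooth3_pd F H). Qed.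
#[local] Hint Resolve smooth3_pd1 smooth3_pd2 smooth3_pd3 : s3.

Definition fsub F H := fadd F (fmul (fcst (-1)) H).
(** The squared distance to the axis, equal to 1 - mu^2 on the sphere. *)
Definition rho := fadd (fmul cx cx) (fmul cy cy).

(** On the sphere, [rot] is d/dlambda and [mer] is (1 - mu^2) d/dmu; unlike
    d/dmu itself, both extend to smooth fields on R^3. *)
Definition rot F := fsub (fmul cx (pd2 F)) (fmul cy (pd1 F)).
Definition mer F :=
  fsub (fmul rho (pd3 F)) (fmul cz (fadd (fmul cx (pd1 F)) (fmul cy (pd2 F)))).
(** The triple product p . (grad F x grad H), an extension of the Poisson bracket. *)
Definition bracket F H :=
  fadd (fmul cz (fsub (fmul (pd1 F) (pd2 H)) (fmul (pd2 F) (pd1 H))))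
  (fadd (fmul cx (fsub (fmul (pd2 F) (pd3 H)) (fmul (pd3 F) (pd2 H))))
        (fmul cy (fsub (fmul (pd3 F) (pd1 H)) (fmul (pd1 F) (pd3 H))))).
(** The Euler field x d/dx + y d/dy + z d/dz. *)
Definition radial F := fadd (fmul cx (pd1 F)) (fadd (fmul cy (pd2 F)) (fmul cz (pd3 F))).
(** The Euclidean Laplacian minus its radial part E^2 + E, where E is the Euler
    field: an extension of the Laplacian of the sphere. *)
Definition lapS F :=
  fsub (fadd (pd1 (pd1 F)) (fadd (pd2 (pd2 F)) (pd3 (pd3 F))))
       (fadd (radial (radial F)) (radial F)).

Lemma smooth3_sub F H : smooth3 F -> smooth3 H -> smooth3 (fsub F H).
Proof. unfold fsub; auto with s3. Qed.
#[local] Hint Resolve smooth3_sub : s3.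
Lemma smooth3_rho : smooth3 rho.
Proof. unfold rho; auto with s3. Qed.
#[local] Hint Resolve smooth3_rho : s3.
Lemma smooth3_rot F : smooth3 F -> smooth3 (rot F).
Proof. unfold rot; auto 10 with s3. Qed.
Lemma smooth3_mer F : smooth3 F -> smooth3 (mer F).
Proof. unfold mer; auto 10 with s3. Qed.
Lemma smooth3_bracket F H : smooth3 F -> smooth3 H -> smooth3 (bracket F H).
Proof. unfold bracket; auto 12 with s3. Qed.
Lemma smooth3_radial F : smooth3 F -> smooth3 (radial F).
Proof. unfold radial; auto 12 with s3. Qed.
#[local] Hint Resolve smooth3_rot smooth3_mer smooth3_bracket smooth3_radial : s3.
Lemma smooth3_lapS F : smooth3 F -> smooth3 (lapS F).
Proof. unfold lapS; auto 12 with s3. Qed.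
#[local] Hint Resolve smooth3_lapS : s3.

(** Rewrites the partial derivatives of polynomial expressions in smooth functions. *)
Ltac pd_simpl :=
  unfold rot, mer, bracket, lapS, radial, fsub, rho;
  repeat (match goal with
  | |- context [pd1 (fadd ?F ?H)] => rewrite (proj1 (pd_add F H ltac:(auto 12 with s3)
      ltac:(auto 12 with s3)))
  | |- context [pd2 (fadd ?F ?H)] => rewrite (proj1 (proj2 (pd_add F H ltac:(auto 12 with s3)
      ltac:(auto 12 with s3))))
  | |- context [pd3 (fadd ?F ?H)] => rewrite (proj2 (proj2 (pd_add F H ltac:(auto 12 with s3)
      ltac:(auto 12 with s3))))
  | |- context [pd1 (fmul ?F ?H)] => rewrite (proj1 (pd_mul F H ltac:(auto 12 with s3)
      ltac:(auto 12 with s3)))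
  | |- context [pd2 (fmul ?F ?H)] => rewrite (proj1 (proj2 (pd_mul F H ltac:(auto 12 with s3)
      ltac:(auto 12 with s3))))
  | |- context [pd3 (fmul ?F ?H)] => rewrite (proj2 (proj2 (pd_mul F H ltac:(auto 12 with s3)
      ltac:(auto 12 with s3))))
  | |- context [pd1 (fcst ?c)] => rewrite (proj1 (pd_cst c))
  | |- context [pd2 (fcst ?c)] => rewrite (proj1 (proj2 (pd_cst c)))
  | |- context [pd3 (fcst ?c)] => rewrite (proj2 (proj2 (pd_cst c)))
  | |- context [pd1 cx] => rewrite (proj1 pd_cx)
  | |- context [pd2 cx] => rewrite (proj1 (proj2 pd_cx))
  | |- context [pd3 cx] => rewrite (proj2 (proj2 pd_cx))
  | |- context [pd1 cy] => rewrite (proj1 pd_cy)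
  | |- context [pd2 cy] => rewrite (proj1 (proj2 pd_cy))
  | |- context [pd3 cy] => rewrite (proj2 (proj2 pd_cy))
  | |- context [pd1 cz] => rewrite (proj1 pd_cz)
  | |- context [pd2 cz] => rewrite (proj1 (proj2 pd_cz))
  | |- context [pd3 cz] => rewrite (proj2 (proj2 pd_cz))
  end);
  repeat (match goal with
  | |- context [pd2 (pd1 ?F)] => rewrite (proj1 (pd_comm F ltac:(auto 12 with s3)))
  | |- context [pd3 (pd1 ?F)] => rewrite (proj1 (proj2 (pd_comm F ltac:(auto 12 with s3))))
  | |- context [pd3 (pd2 ?F)] => rewrite (proj2 (proj2 (pd_comm F ltac:(auto 12 with s3))))
  end);
  unfold fadd, fmul, fcst.

Lemma mer_rot F : smooth3 F -> mer (rot F) = rot (mer F).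
Proof.
  intros HF; apply functional_extensionality; intros p.
  pd_simpl. ring.
Qed.

Lemma bracket_fields F H p : rho p * bracket F H p = rot F p * mer H p - mer F p * rot H p.
Proof. unfold bracket, rot, mer, rho, fsub, fadd, fmul, fcst; ring. Qed.

Lemma lapS_fields F p : smooth3 F -> rho p + cz p * cz p = 1 ->
  rho p * lapS F p = mer (mer F) p + rot (rot F) p.
Proof.
  intros HF. pd_simpl. intros Hp.
  set (x := cx p) in *; set (y := cy p) in *; set (z := cz p) in *.
  apply Rminus_diag_uniq.
  (* Both sides differ by a multiple of 1 - (x^2 + y^2 + z^2). *)
  match goal with |- ?L = 0 => replace L with
   ((1 - (x * x + y * y + z * z)) * (x * x * pd1 (pd1 F) p + 2 * x * y * pd1 (pd2 F) p
      + y * y * pd2 (pd2 F) p + (x * x + y * y) * pd3 (pd3 F) p + x * pd1 F p + y * pd2 F p))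
          end.
  - rewrite Hp; ring.
  - ring.
Qed.

Lemma bracket_leibniz F H K : smooth3 F -> smooth3 H -> smooth3 K ->
  bracket F (fmul H K) = fadd (fmul (bracket F H) K) (fmul H (bracket F K)).
Proof.
  intros HF HH HK; apply functional_extensionality; intros p.
  pd_simpl. ring.
Qed.

(** * Integration over the sphere *)

Lemma interior_pos u : -1 < u < 1 -> 0 < 1 - u ^ 2.
Proof. intros; nra. Qed.

Lemma rho_sphere l u : -1 <= u <= 1 -> rho (sphere_pt l u) = 1 - u ^ 2.
Proof.
  intros Hu. unfold rho, fadd, fmul, cx, cy, sphere_pt; cbn [fst snd].
  pose proof (sqrt_sqrt (1 - u ^ 2) ltac:(nra)) as E.
  pose proof (sin2_cos2 l) as T; unfold Rsqr in T.
  replace (sqrt (1 - u ^ 2) * cos l * (sqrt (1 - u ^ 2) * cos l) + sqrt (1 - u ^ 2) * sin l *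
      (sqrt (1 - u ^ 2) * sin l)) with ((sqrt (1 - u ^ 2) * sqrt (1 - u ^ 2)) * (sin l * sin l
      + cos l * cos l)) by ring.
  rewrite E, T; ring.
Qed.

Lemma is_derive_sphere_lambda F l u : differentiable3 F ->
  is_derive (fun t => F (sphere_pt t u)) l (rot F (sphere_pt l u)).
Proof.
  intros HF. unfold sphere_pt.
  evar_last.
  apply (is_derive_path F (fun t => sqrt (1 - u ^ 2) * cos t)
    (fun t => sqrt (1 - u ^ 2) * sin t) (fun _ => u)); trivial.
  - auto_derive; [trivial | reflexivity].
  - auto_derive; [trivial | reflexivity].
  - apply is_derive_cstR.
  - unfold rot, fsub, fadd, fmul, fcst, cx, cy; cbn [fst snd].
    replace (1 - u * (u * 1)) with (1 - u ^ 2) by ring. ring.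
Qed.

Lemma is_derive_sphere_mu F l u : differentiable3 F -> -1 < u < 1 ->
  is_derive (fun t => F (sphere_pt l t)) u (mer F (sphere_pt l u) / (1 - u ^ 2)).
Proof.
  intros HF Hu. pose proof (interior_pos u Hu) as Hp.
  pose proof (sqrt_lt_R0 _ Hp) as Hs.
  pose proof (rho_sphere l u ltac:(lra)) as Hr.
  unfold mer, fsub at 1, fadd at 1, fmul at 1. rewrite Hr.
  pose proof (sqrt_sqrt (1 - u ^ 2) ltac:(lra)) as E.
  unfold sphere_pt.
  evar_last.
  apply (is_derive_path F (fun t => sqrt (1 - t ^ 2) * cos l)
    (fun t => sqrt (1 - t ^ 2) * sin l) (fun t => t)); trivial.
  - auto_derive; [simpl in Hp; exact Hp | reflexivity].
  - auto_derive; [simpl in Hp; exact Hp | reflexivity].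
  - apply is_derive_idR.
  - unfold fadd, fmul, fcst, cx, cy, cz; cbn [fst snd].
    set (A := pd1 F _). set (B := pd2 F _). set (C := pd3 F _).
    replace (1 + - (u * (u * 1))) with (1 - u ^ 2) by ring.
    set (s := sqrt (1 - u ^ 2)) in *. rewrite <- E. field. lra.
Qed.

(** Continuity holds for all [u], since [sqrt] vanishes on negative numbers. *)
Lemma continuity_2d_sphere F l u : differentiable3 F ->
  continuity_2d_pt (fun a b => F (sphere_pt a b)) l u.
Proof.
  intros HF. unfold sphere_pt.
  assert (S : continuity_2d_pt (fun _ b => sqrt (1 - b ^ 2)) l u).
  { apply continuity_1d_2d_pt_comp.
    - apply continuity_pt_filterlim, continuous_sqrt.
    - apply continuity_2d_pt_minus; [apply continuity_2d_pt_const |].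
      apply continuity_2d_pt_ext with (fun _ b => b * b); [intros; ring |].
      apply continuity_2d_pt_mult; apply continuity_2d_pt_id2. }
  apply (continuity_2d_comp3 F (fun a b => sqrt (1 - b ^ 2) * cos a)
    (fun a b => sqrt (1 - b ^ 2) * sin a) (fun _ b => b)); trivial.
  - apply continuity_2d_pt_mult; trivial.
    apply (continuity_1d_2d_pt_comp cos (fun a _ => a)); [| apply continuity_2d_pt_id1].
    apply continuity_cos.
  - apply continuity_2d_pt_mult; trivial.
    apply (continuity_1d_2d_pt_comp sin (fun a _ => a)); [| apply continuity_2d_pt_id1].
    apply continuity_sin.
  - apply continuity_2d_pt_id2.
Qed.

Lemma continuous_section f u l : continuity_2d_pt f l u -> continuous (fun a => f a u) l.
Proof.
  intros H. apply continuity_2d_pt_filterlim in H.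
  intros P HP. destruct (H P HP) as [e He]. exists e. intros y Hy.
  apply (He (y, u)). split; [exact Hy | apply ball_center].
Qed.

Lemma continuous_RInt_section f a b u : a <= b ->
  (forall l v, continuity_2d_pt f l v) ->
  continuous (fun v => RInt (fun l => f l v) a b) u.
Proof.
  intros Hab H.
  assert (EX : forall v, ex_RInt (fun l => f l v) a b).
  { intros v; apply (ex_RInt_continuous (V := R_CompleteNormedModule)).
    intros; now apply continuous_section. }
  apply filterlim_locally. intros eps.
  (* This bound on the integrand makes the integral smaller than eps. *)
  assert (Hd : 0 < eps / (b - a + 1) / 2).
  { destruct eps as [e He]; simpl. apply Rdiv_lt_0_compat; [apply Rdiv_lt_0_compat |]; lra. }
  destruct (uniform_continuity_2d_1d f a b u (fun l _ => H l u) (mkposreal _ Hd)) as [d D].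
  exists d. intros v Hv. change (Rabs (v - u) < d) in Hv.
  change (Rabs (minus (RInt (fun l => f l v) a b) (RInt (fun l => f l u) a b)) < eps).
  rewrite <- (RInt_minus (V := R_CompleteNormedModule) (fun l => f l v) (fun l => f l u) a b
      (EX v) (EX u)).
  eapply Rle_lt_trans.
  - apply abs_RInt_le_const with (M := eps / (b - a + 1) / 2); trivial.
    + apply (ex_RInt_minus (V := R_CompleteNormedModule)); apply EX.
    + intros t Ht. left. apply (D t u t v); trivial.
      * destruct d; simpl; lra.
      * apply Rabs_lt_between' in Hv; lra.
      * rewrite Rminus_eq_0, Rabs_R0; apply d.
  - destruct eps as [e He]; simpl.
    replace ((b - a) * (e / (b - a + 1) / 2)) with (e * ((b - a) / (b - a + 1) / 2)) by (field;
        lra).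
    assert ((b - a) / (b - a + 1) < 1) by (apply Rlt_div_l; lra).
    nra.
Qed.

(** Integral of F over the circle of latitude of height u. *)
Definition circ (F : R * R * R -> R) (u : R) : R := RInt (fun l => F (sphere_pt l u)) 0 (2 *
    PI).
(** Integral of F over the sphere, for the measure dlambda dmu. *)
Definition sphere_int (F : R * R * R -> R) : R := RInt (circ F) (-1) 1.

Lemma ex_circ F u : differentiable3 F -> ex_RInt (fun l => F (sphere_pt l u)) 0 (2 * PI).
Proof.
  intros HF. apply (ex_RInt_continuous (V := R_CompleteNormedModule)); intros z _.
  apply (continuous_section (fun a b => F (sphere_pt a b))), continuity_2d_sphere, HF.
Qed.

Lemma continuous_circ F u : differentiable3 F -> continuous (circ F) u.
Proof.
  intros HF. apply (continuous_RInt_section (fun a b => F (sphere_pt a b))).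
  - pose proof PI_RGT_0; lra.
  - intros; now apply continuity_2d_sphere.
Qed.

Lemma ex_sphere_int F : differentiable3 F -> ex_RInt (circ F) (-1) 1.
Proof.
  intros HF. apply (ex_RInt_continuous (V := R_CompleteNormedModule)); intros z _.
  now apply continuous_circ.
Qed.

(** A lambda-derivative integrates to 0 over a circle of latitude. *)
Lemma circ_rot J u : smooth3 J -> circ (rot J) u = 0.
Proof.
  intros HJ. unfold circ.
  assert (I : is_RInt (fun l => rot J (sphere_pt l u)) 0 (2 * PI)
    (minus (J (sphere_pt (2 * PI) u)) (J (sphere_pt 0 u)))).
  { apply (is_RInt_derive (fun l => J (sphere_pt l u))).
    - intros; apply is_derive_sphere_lambda; auto with s3.
    - intros; apply (continuous_section (fun a b => rot J (sphere_pt a b))),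
        continuity_2d_sphere; auto with s3. }
  rewrite (is_RInt_unique _ _ _ _ I).
  unfold sphere_pt. rewrite cos_2PI, sin_2PI, cos_0, sin_0.
  apply Rminus_diag_eq; reflexivity.
Qed.

Lemma is_derive_circ K u : smooth3 K -> -1 < u < 1 ->
  is_derive (circ K) u (circ (mer K) u / (1 - u ^ 2)).
Proof.
  intros HK Hu. pose proof (interior_pos u Hu) as Hp.
  assert (L : locally u (fun v => -1 < v < 1)).
  { apply (locally_interval _ u (-1) 1); simpl; try lra. intros; lra. }
  evar_last.
  - apply (is_derive_RInt_param (fun v l => K (sphere_pt l v)) 0 (2 * PI) u).
    + revert L; apply filter_imp. intros v Hv t _. eexists.
      apply is_derive_sphere_mu; auto with s3.
    + intros t _.
      apply continuity_2d_pt_ext_loc with (fun a b => mer K (sphere_pt b a) * / (1 - a ^ 2)).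
      * destruct L as [d Hd]. exists d. intros a b Ha _. symmetry.
        apply is_derive_unique. apply (is_derive_sphere_mu K b a); auto with s3.
      * apply continuity_2d_pt_mult.
        -- pose proof (continuity_2d_sphere (mer K) t u ltac:(auto with s3)) as C.
           intros e. destruct (C e) as [d Hd]. exists d. intros a b Ha Hb. now apply Hd.
        -- apply (continuity_2d_pt_inv (fun a _ => 1 - a ^ 2)); [| lra].
           apply continuity_2d_pt_minus; [apply continuity_2d_pt_const |].
           apply continuity_2d_pt_ext with (fun a _ => a * a); [intros; ring |].
           apply continuity_2d_pt_mult; apply continuity_2d_pt_id1.
    + apply filter_forall. intros v. apply ex_circ; auto with s3.
  - rewrite (RInt_ext (V := R_CompleteNormedModule) _ (fun l => scal (/ (1 - u ^ 2)) (mer K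
      (sphere_pt l u)))).
    + rewrite (RInt_scal (V := R_CompleteNormedModule)) by (apply ex_circ; auto with s3).
      unfold scal, circ; simpl; unfold mult; simpl. field. lra.
    + intros l _. unfold scal; simpl; unfold mult; simpl.
      rewrite Rmult_comm.
      apply is_derive_unique, (is_derive_sphere_mu K l u); auto with s3.
Qed.

Lemma circ_ext F H u : (forall l, F (sphere_pt l u) = H (sphere_pt l u)) -> circ F u = circ H u.
Proof. intros E; apply (RInt_ext (V := R_CompleteNormedModule)); intros; apply E. Qed.

Lemma circ_add F H u : differentiable3 F -> differentiable3 H -> circ (fadd F H) u = circ F u +
    circ H u.
Proof.
  intros HF HH. apply (RInt_plus (V := R_CompleteNormedModule) (fun l => F (sphere_pt l u))
      (fun l => H (sphere_pt l u)));
    now apply ex_circ.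
Qed.

Lemma circ_scal c F u : differentiable3 F -> circ (fmul (fcst c) F) u = c * circ F u.
Proof.
  intros HF.
  exact (RInt_scal (V := R_CompleteNormedModule) (fun l => F (sphere_pt l u))
    0 (2 * PI) c (ex_circ F u HF)).
Qed.

Lemma sphere_int_add F H : differentiable3 F -> differentiable3 H ->
  sphere_int (fadd F H) = sphere_int F + sphere_int H.
Proof.
  intros HF HH. unfold sphere_int.
  rewrite <- (RInt_plus (V := R_CompleteNormedModule) (circ F) (circ H)) by now apply
      ex_sphere_int.
  apply (RInt_ext (V := R_CompleteNormedModule)); intros; now apply circ_add.
Qed.

Lemma sphere_int_scal c F : differentiable3 F -> sphere_int (fmul (fcst c) F) = c * sphere_int
    F.
Proof.
  intros HF. unfold sphere_int.
  transitivity (RInt (V := R_CompleteNormedModule) (fun u => scal c (circ F u)) (-1) 1);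
    [| exact (RInt_scal (V := R_CompleteNormedModule) (circ F) (-1) 1 c (ex_sphere_int F HF))].
  apply (RInt_ext (V := R_CompleteNormedModule)); intros; now apply circ_scal.
Qed.

(** The divergence theorem on the sphere: the hypotheses say that
    N = dK/dmu - (1 - mu^2)^{-1} dJ/dlambda away from the poles, and that K vanishes
    on the axis. *)
Lemma sphere_int_divergence K J N : smooth3 K -> smooth3 J -> smooth3 N ->
  (forall l u, -1 < u < 1 -> 
     rho (sphere_pt l u) * N (sphere_pt l u) = mer K (sphere_pt l u) - rot J (sphere_pt l u)) ->
  (forall p, rho p = 0 -> K p = 0) ->
  sphere_int N = 0.
Proof.
  intros HK HJ HN E K0.
  assert (D : forall u, -1 < u < 1 -> is_derive (circ K) u (circ N u)).
  { intros u Hu. pose proof (interior_pos u Hu) as Hp.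
    evar_last; [now apply is_derive_circ |].
    rewrite (circ_ext (mer K) (fadd (fmul (fcst (1 - u ^ 2)) N) (rot J))).
    - rewrite circ_add, circ_scal, circ_rot by auto with s3. field; lra.
    - intros l. unfold fadd, fmul, fcst.
      rewrite <- (rho_sphere l u), E by lra. ring. }
  assert (W : forall u, is_derive (fun u => RInt (circ N) (-1) u) u (circ N u)).
  { intros u. apply is_derive_RInt with (-1).
    - apply filter_forall. intros v. apply RInt_correct.
      apply (ex_RInt_continuous (V := R_CompleteNormedModule)); intros.
      apply continuous_circ; auto with s3.
    - apply continuous_circ; auto with s3. }
  (* The primitive of [circ N] and [circ K] have the same derivative inside
     (-1, 1); at the poles [circ K] is only continuous. *)
  destruct (MVT_gen (fun u => RInt (circ N) (-1) u - circ K u) (-1) 1 (fun _ => 0)) as [c [_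
      Hc]].
  - intros u Hu. rewrite Rmin_left, Rmax_right in Hu by lra.
    replace 0 with (minus (circ N u) (circ N u)) by apply Rminus_eq_0.
    apply (is_derive_minus (V := R_NormedModule)); auto.
  - intros u _. apply continuity_pt_filterlim.
    apply (continuous_minus (V := R_NormedModule)).
    + apply (ex_derive_continuous (V := R_NormedModule)). eexists; apply W.
    + apply continuous_circ; auto with s3.
  - assert (Z : forall u, u ^ 2 = 1 -> -1 <= u <= 1 -> circ K u = 0).
    { intros u Hu Hu'. unfold circ. rewrite (RInt_ext (V := R_CompleteNormedModule) _ (fun _ =>
        0)).
      - rewrite RInt_const. unfold scal; simpl; unfold mult; simpl; ring.
      - intros l _. apply K0. rewrite rho_sphere by trivial. lra. }
    rewrite RInt_point in Hc. rewrite (Z 1), (Z (-1)) in Hc by lra.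
    unfold sphere_int. unfold zero in Hc; simpl in Hc. lra.
Qed.

(** {F, H} = d/dmu (H dF/dlambda) - d/dlambda (H dF/dmu). *)
Lemma sphere_int_bracket F H : smooth3 F -> smooth3 H -> sphere_int (bracket F H) = 0.
Proof.
  intros HF HH.
  apply (sphere_int_divergence (fmul (rot F) H) (fmul (mer F) H)); auto with s3.
  - intros l u _. rewrite bracket_fields.
    assert (E1 : mer (fmul (rot F) H) = fadd (fmul (mer (rot F)) H) (fmul (rot F) (mer H))).
    { apply functional_extensionality; intros p. pd_simpl. ring. }
    assert (E2 : rot (fmul (mer F) H) = fadd (fmul (rot (mer F)) H) (fmul (mer F) (rot H))).
    { apply functional_extensionality; intros p. pd_simpl. ring. }
    rewrite E1, E2, mer_rot by trivial. unfold fadd, fmul. ring.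
  - intros p Hp. unfold rho, fadd, fmul in Hp.
    assert (cx p = 0 /\ cy p = 0) as [Hx Hy] by (split; nra).
    unfold rot, fsub, fadd, fmul. rewrite Hx, Hy. ring.
Qed.

Lemma sphere_unit l u : -1 <= u <= 1 -> rho (sphere_pt l u) + cz (sphere_pt l u) * cz
    (sphere_pt l u) = 1.
Proof. intros; rewrite rho_sphere by trivial. unfold cz, sphere_pt; cbn [fst snd]. ring. Qed.

(** Green's formula. *)
Lemma sphere_int_lapS F H : smooth3 F -> smooth3 H ->
  sphere_int (fsub (fmul (lapS F) H) (fmul F (lapS H))) = 0.
Proof.
  intros HF HH.
  apply (sphere_int_divergence (fsub (fmul (mer F) H) (fmul F (mer H)))
     (fsub (fmul F (rot H)) (fmul (rot F) H))); auto 6 with s3.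
  - intros l u Hu.
    pose proof (lapS_fields F (sphere_pt l u) HF (sphere_unit l u ltac:(lra))) as EF.
    pose proof (lapS_fields H (sphere_pt l u) HH (sphere_unit l u ltac:(lra))) as EH.
    set (p := sphere_pt l u) in *.
    transitivity ((rho p * lapS F p) * H p - F p * (rho p * lapS H p)).
    { unfold fsub, fadd, fmul, fcst; ring. }
    rewrite EF, EH.
    assert (E1 : forall A B, smooth3 A -> smooth3 B -> mer (fmul A B) p = mer A p * B p + A p *
        mer B p).
    { intros A B HA HB. pd_simpl. ring. }
    assert (E2 : forall A B, smooth3 A -> smooth3 B -> rot (fmul A B) p = rot A p * B p + A p *
        rot B p).
    { intros A B HA HB. pd_simpl. ring. }
    assert (E3 : forall A B, smooth3 A -> smooth3 B -> mer (fsub A B) p = mer A p - mer B p).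
    { intros A B HA HB. pd_simpl. ring. }
    assert (E4 : forall A B, smooth3 A -> smooth3 B -> rot (fsub A B) p = rot A p - rot B p).
    { intros A B HA HB. pd_simpl. ring. }
    rewrite E3, E4, !E1, !E2 by auto with s3. ring.
  - intros p Hp. unfold rho, fadd, fmul in Hp.
    assert (cx p = 0 /\ cy p = 0) as [Hx Hy] by (split; nra).
    unfold mer, rho, fsub, fadd, fmul, fcst. rewrite Hx, Hy. ring.
Qed.

(** * Complex functions on the sphere *)

(** F1 and F2 are smooth extensions to R^3 of the real and imaginary parts of f. *)
Definition represents (f : R -> R -> C) (F1 F2 : R * R * R -> R) : Prop :=
  smooth3 F1 /\ smooth3 F2 /\
  forall l u, -1 < u < 1 -> f l u = (F1 (sphere_pt l u), F2 (sphere_pt l u)).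

Lemma represents_smooth f F1 F2 : represents f F1 F2 -> smooth_S2 f.
Proof. intros (H1 & H2 & E); exists F1, F2; now repeat split. Qed.

Lemma smooth_represents f : smooth_S2 f -> exists F1 F2, represents f F1 F2.
Proof. intros (F1 & F2 & H1 & H2 & E); exists F1, F2; now repeat split. Qed.

Lemma represents_ext f h F1 F2 : eq_S2 f h -> represents f F1 F2 -> represents h F1 F2.
Proof.
  intros E (H1 & H2 & H). repeat split; trivial.
  intros l u Hu. rewrite <- H by trivial. symmetry; now apply E.
Qed.

Lemma represents_add f h F1 F2 H1 H2 : represents f F1 F2 -> represents h H1 H2 ->
  represents (fun l u => f l u + h l u)%C (fadd F1 H1) (fadd F2 H2).
Proof.
  intros (A1 & A2 & A) (B1 & B2 & B). split; [|split]; auto with s3.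
  intros l u Hu. now rewrite A, B.
Qed.

Lemma represents_mul f h F1 F2 H1 H2 : represents f F1 F2 -> represents h H1 H2 ->
  represents (fun l u => f l u * h l u)%C (fsub (fmul F1 H1) (fmul F2 H2)) (fadd (fmul F1 H2)
      (fmul F2 H1)).
Proof.
  intros (A1 & A2 & A) (B1 & B2 & B). split; [|split]; auto with s3.
  intros l u Hu. rewrite A, B by trivial.
  unfold fsub, fadd, fmul, fcst, Cmult; simpl. f_equal; ring.
Qed.

Lemma represents_cst c : represents (fun _ _ => c) (fcst (fst c)) (fcst (snd c)).
Proof. split; [|split]; auto with s3. intros; now destruct c. Qed.

Lemma represents_height : represents height cz (fcst 0).
Proof. split; [|split]; auto with s3. Qed.

Lemma represents_d_lambda f F1 F2 : represents f F1 F2 ->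
  represents (d_lambda f) (rot F1) (rot F2).
Proof.
  intros (A1 & A2 & A). split; [|split]; auto with s3.
  intros l u Hu. unfold d_lambda, CDer. f_equal.
  - rewrite (Derive_ext _ (fun t => F1 (sphere_pt t u))) by (intros; now rewrite A).
    apply is_derive_unique, is_derive_sphere_lambda; auto with s3.
  - rewrite (Derive_ext _ (fun t => F2 (sphere_pt t u))) by (intros; now rewrite A).
    apply is_derive_unique, is_derive_sphere_lambda; auto with s3.
Qed.

Lemma locally_interior u : -1 < u < 1 -> locally u (fun v => -1 < v < 1).
Proof. intros. apply (locally_interval _ u (-1) 1); simpl; try lra. intros; lra. Qed.

Lemma represents_d_mu f F1 F2 l u : represents f F1 F2 -> -1 < u < 1 ->
  d_mu f l u = (mer F1 (sphere_pt l u) / (1 - u ^ 2), mer F2 (sphere_pt l u) / (1 - u ^ 2)).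
Proof.
  intros (A1 & A2 & A) Hu. unfold d_mu, CDer. f_equal.
  - rewrite (Derive_ext_loc _ (fun t => F1 (sphere_pt l t))).
    + apply is_derive_unique, is_derive_sphere_mu; auto with s3.
    + generalize (locally_interior u Hu). apply filter_imp. intros v Hv; now rewrite A.
  - rewrite (Derive_ext_loc _ (fun t => F2 (sphere_pt l t))).
    + apply is_derive_unique, is_derive_sphere_mu; auto with s3.
    + generalize (locally_interior u Hu). apply filter_imp. intros v Hv; now rewrite A.
Qed.

Lemma represents_poisson f h F1 F2 H1 H2 : represents f F1 F2 -> represents h H1 H2 ->
  represents (poisson f h) (fsub (bracket F1 H1) (bracket F2 H2))
    (fadd (bracket F1 H2) (bracket F2 H1)).
Proof.
  intros RF RH.
  pose proof (represents_d_lambda _ _ _ RF) as (_ & _ & LF).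
  pose proof (represents_d_lambda _ _ _ RH) as (_ & _ & LH).
  split; [|split]; [destruct RF as (? & ? & ?), RH as (? & ? & ?); auto with s3 .. |].
  intros l u Hu. unfold poisson.
  rewrite LF, LH, (represents_d_mu f F1 F2), (represents_d_mu h H1 H2) by trivial.
  pose proof (interior_pos u Hu) as Hp.
  pose proof (rho_sphere l u ltac:(lra)) as Hr.
  assert (E : forall F H, bracket F H (sphere_pt l u) =
    (rot F (sphere_pt l u) * mer H (sphere_pt l u) - mer F (sphere_pt l u) * rot H (sphere_pt l
        u)) / (1 - u ^ 2)).
  { intros F H. rewrite <- bracket_fields, Hr. field. lra. }
  unfold fsub, fadd, fmul, fcst. rewrite !E.
  unfold Cmult, Cminus, Cplus, Copp; simpl fst; simpl snd. f_equal; field; nra.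
Qed.

Lemma represents_laplacian f F1 F2 : represents f F1 F2 ->
  represents (laplacian f) (lapS F1) (lapS F2).
Proof.
  intros RF.
  assert (RM : represents (fun l u => RtoC (1 - u ^ 2) * d_mu f l u)%C (mer F1) (mer F2)).
  { split; [|split]; [destruct RF as (? & ? & ?); auto with s3 .. |].
    intros l u Hu. rewrite (represents_d_mu f F1 F2) by trivial.
    pose proof (interior_pos u Hu) as Hp.
    unfold Cmult, RtoC; cbn [fst snd]. f_equal; field; lra. }
  pose proof (represents_d_lambda _ _ _ (represents_d_lambda _ _ _ RF)) as (_ & _ & LL).
  assert (S : smooth3 F1 /\ smooth3 F2) by (split; apply RF).
  split; [|split]; [destruct S; auto with s3 .. |].
  intros l u Hu. unfold laplacian.
  rewrite (represents_d_mu _ _ _ l u RM Hu), LL by trivial.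
  pose proof (interior_pos u Hu) as Hp.
  assert (E : forall F, smooth3 F -> lapS F (sphere_pt l u) =
    (mer (mer F) (sphere_pt l u) + rot (rot F) (sphere_pt l u)) / (1 - u ^ 2)).
  { intros F HF. rewrite <- (lapS_fields F _ HF (sphere_unit l u ltac:(lra))), rho_sphere by
      lra.
    field. lra. }
  rewrite !E by apply S.
  unfold Cmult, Cplus, RtoC; cbn [fst snd]. f_equal; field; lra.
Qed.

(** Integral of a complex function over the sphere, as in [pairing]. *)
Definition sint (f : R -> R -> C) : C :=
  RInt (V := C_R_CompleteNormedModule)
    (fun mu => RInt (V := C_R_CompleteNormedModule) (fun lambda => f lambda mu) 0 (2 * PI))
    (-1) 1.

Lemma sint_represents f F1 F2 : represents f F1 F2 -> sint f = (sphere_int F1, sphere_int F2).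
Proof.
  intros (A1 & A2 & A).
  assert (P : forall (g : R -> C) (g1 g2 : R -> R) a b, a < b -> (forall t, a < t < b -> g t =
      (g1 t, g2 t)) ->
     ex_RInt g1 a b -> ex_RInt g2 a b ->
     RInt (V := C_R_CompleteNormedModule) g a b = (RInt g1 a b, RInt g2 a b)).
  { intros g g1 g2 a b Hab E E1 E2. apply is_RInt_unique.
    apply (is_RInt_ext (V := C_R_CompleteNormedModule) (fun t => (g1 t, g2 t))).
    - intros t Ht. rewrite Rmin_left, Rmax_right in Ht by lra. symmetry; now apply E.
    - apply (is_RInt_fct_extend_pair (U := R_NormedModule) (V := R_NormedModule) (fun t => (g1
        t, g2 t)));
        apply (RInt_correct (V := R_CompleteNormedModule)); assumption. }
  unfold sint, sphere_int; apply P; [lra | | apply ex_sphere_int; auto with s3 ..].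
  intros u Hu. unfold circ; apply P.
  - pose proof PI_RGT_0; lra.
  - intros; now apply A.
  - apply ex_circ; auto with s3.
  - apply ex_circ; auto with s3.
Qed.

Lemma sint_ext f h : eq_S2 f h -> sint f = sint h.
Proof.
  intros E. unfold sint. apply (RInt_ext (V := C_R_CompleteNormedModule)). intros u Hu.
  rewrite Rmin_left, Rmax_right in Hu by lra.
  apply (RInt_ext (V := C_R_CompleteNormedModule)). intros; now apply E.
Qed.

Lemma sint_add f h : smooth_S2 f -> smooth_S2 h ->
  sint (fun l u => f l u + h l u)%C = (sint f + sint h)%C.
Proof.
  intros (F1 & F2 & RF)%smooth_represents (H1 & H2 & RH)%smooth_represents.
  rewrite (sint_represents _ _ _ (represents_add _ _ _ _ _ _ RF RH)),
    (sint_represents _ _ _ RF), (sint_represents _ _ _ RH).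
  destruct RF as (? & ? & _), RH as (? & ? & _).
  rewrite !sphere_int_add by auto with s3. reflexivity.
Qed.

Lemma sphere_int_sub F H : smooth3 F -> smooth3 H ->
  sphere_int (fsub F H) = sphere_int F - sphere_int H.
Proof.
  intros HF HH. unfold fsub. rewrite sphere_int_add, sphere_int_scal by auto with s3. ring.
Qed.

Lemma sint_scal (c : C) f : smooth_S2 f ->
  sint (fun l u => c * f l u)%C = (c * sint f)%C.
Proof.
  intros (F1 & F2 & RF)%smooth_represents.
  rewrite (sint_represents _ _ _ (represents_mul _ _ _ _ _ _ (represents_cst c) RF)),
    (sint_represents _ _ _ RF).
  destruct RF as (? & ? & _).
  rewrite sphere_int_sub, sphere_int_add, !sphere_int_scal by auto with s3. reflexivity.
Qed.

Lemma sint_poisson f h : smooth_S2 f -> smooth_S2 h -> sint (poisson f h) = RtoC 0.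
Proof.
  intros (F1 & F2 & RF)%smooth_represents (H1 & H2 & RH)%smooth_represents.
  rewrite (sint_represents _ _ _ (represents_poisson _ _ _ _ _ _ RF RH)).
  destruct RF as (? & ? & _), RH as (? & ? & _).
  rewrite sphere_int_sub, sphere_int_add, !sphere_int_bracket by auto with s3.
  unfold RtoC; f_equal; ring.
Qed.

Lemma smooth_ext f h : eq_S2 f h -> smooth_S2 f -> smooth_S2 h.
Proof.
  intros E (F1 & F2 & RF)%smooth_represents.
  exact (represents_smooth _ _ _ (represents_ext _ _ _ _ E RF)).
Qed.
Lemma smooth_add f h : smooth_S2 f -> smooth_S2 h -> smooth_S2 (fun l u => f l u + h l u)%C.
Proof.
  intros (F1 & F2 & RF)%smooth_represents (H1 & H2 & RH)%smooth_represents.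
  exact (represents_smooth _ _ _ (represents_add _ _ _ _ _ _ RF RH)).
Qed.
Lemma smooth_mul f h : smooth_S2 f -> smooth_S2 h -> smooth_S2 (fun l u => f l u * h l u)%C.
Proof.
  intros (F1 & F2 & RF)%smooth_represents (H1 & H2 & RH)%smooth_represents.
  exact (represents_smooth _ _ _ (represents_mul _ _ _ _ _ _ RF RH)).
Qed.
Lemma smooth_cst (c : C) : smooth_S2 (fun _ _ => c).
Proof. exact (represents_smooth _ _ _ (represents_cst c)). Qed.
Lemma smooth_height : smooth_S2 height.
Proof. exact (represents_smooth _ _ _ represents_height). Qed.
Lemma smooth_scal (c : C) f : smooth_S2 f -> smooth_S2 (fun l u => c * f l u)%C.
Proof. intros; apply (smooth_mul (fun _ _ => c)); auto using smooth_cst. Qed.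
Lemma smooth_poisson f h : smooth_S2 f -> smooth_S2 h -> smooth_S2 (poisson f h).
Proof.
  intros (F1 & F2 & RF)%smooth_represents (H1 & H2 & RH)%smooth_represents.
  exact (represents_smooth _ _ _ (represents_poisson _ _ _ _ _ _ RF RH)).
Qed.
Lemma smooth_laplacian f : smooth_S2 f -> smooth_S2 (laplacian f).
Proof.
  intros (F1 & F2 & RF)%smooth_represents.
  exact (represents_smooth _ _ _ (represents_laplacian _ _ _ RF)).
Qed.
#[local] Hint Resolve smooth_add smooth_mul smooth_cst smooth_height smooth_scal
  smooth_poisson smooth_laplacian : s3.

Lemma pairingE f h : pairing f h = sint (fun l u => f l u * h l u)%C.
Proof. reflexivity. Qed.

(** * The pairing *)

Lemma pairing_sym f h : pairing f h = pairing h f.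
Proof. rewrite !pairingE. apply sint_ext. intros l u _. apply Cmult_comm. Qed.

Lemma pairing_ext f f' h h' : eq_S2 f f' -> eq_S2 h h' -> pairing f h = pairing f' h'.
Proof. intros E E'. rewrite !pairingE. apply sint_ext. intros l u Hu. now rewrite (E l u Hu),
    (E' l u Hu). Qed.

Lemma pairing_addl f f' h : smooth_S2 f -> smooth_S2 f' -> smooth_S2 h ->
  pairing (fun l u => f l u + f' l u)%C h = (pairing f h + pairing f' h)%C.
Proof.
  intros Hf Hf' Hh. rewrite !pairingE.
  transitivity (sint (fun l u => f l u * h l u + f' l u * h l u)%C).
  - apply sint_ext; intros l u _; ring.
  - apply (sint_add (fun l u => f l u * h l u)%C (fun l u => f' l u * h l u)%C); auto with s3.
Qed.

Lemma pairing_scall (c : C) f h : smooth_S2 f -> smooth_S2 h ->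
  pairing (fun l u => c * f l u)%C h = (c * pairing f h)%C.
Proof.
  intros Hf Hh. rewrite !pairingE.
  transitivity (sint (fun l u => c * (f l u * h l u))%C).
  - apply sint_ext; intros l u _; ring.
  - apply (sint_scal c (fun l u => f l u * h l u)%C); auto with s3.
Qed.

Lemma poisson_antisym f h l u : poisson f h l u = (- poisson h f l u)%C.
Proof. unfold poisson; ring. Qed.

Lemma poisson_leibniz f g h : smooth_S2 f -> smooth_S2 g -> smooth_S2 h ->
  eq_S2 (poisson g (fun l u => f l u * h l u)%C)
    (fun l u => poisson g f l u * h l u + f l u * poisson g h l u)%C.
Proof.
  intros (F1 & F2 & RF)%smooth_represents (G1 & G2 & RG)%smooth_represents (H1 & H2 &
      RH)%smooth_represents.
  pose proof (represents_poisson _ _ _ _ _ _ RG (represents_mul _ _ _ _ _ _ RF RH)) as (_ & _ &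
      E1).
  pose proof (represents_poisson _ _ _ _ _ _ RG RF) as (_ & _ & E2).
  pose proof (represents_poisson _ _ _ _ _ _ RG RH) as (_ & _ & E3).
  intros l u Hu. rewrite E1, E2, E3 by trivial.
  destruct RF as (? & ? & E4), RG as (? & ? & _), RH as (? & ? & E5).
  rewrite E4, E5 by trivial.
  assert (BA : forall A B K, smooth3 A -> smooth3 B -> smooth3 K ->
    bracket A (fadd B K) = fadd (bracket A B) (bracket A K)).
  { intros A B K ? ? ?. apply functional_extensionality; intros p. pd_simpl. ring. }
  assert (BS : forall A B K, smooth3 A -> smooth3 B -> smooth3 K ->
    bracket A (fsub B K) = fsub (bracket A B) (bracket A K)).
  { intros A B K ? ? ?. apply functional_extensionality; intros p. pd_simpl. ring. }
  rewrite !BA, !BS, !bracket_leibniz by auto with s3.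
  unfold Cmult, Cplus, fsub, fadd, fmul, fcst; cbn [fst snd]. f_equal; ring.
Qed.

(** Invariance of the pairing: the integral of {g, f h} vanishes. *)
Lemma pairing_poisson f g h : smooth_S2 f -> smooth_S2 g -> smooth_S2 h ->
  pairing (poisson f g) h = pairing f (poisson g h).
Proof.
  intros Hf Hg Hh.
  assert (E : (pairing (poisson g f) h + pairing f (poisson g h))%C = RtoC 0).
  { rewrite <- (sint_poisson g (fun l u => f l u * h l u)%C) by auto with s3.
    rewrite (sint_ext _ _ (poisson_leibniz f g h Hf Hg Hh)).
    rewrite !pairingE; symmetry; apply (sint_add (fun l u => poisson g f l u * h l u)%C (fun l
        u => f l u * poisson g h l u)%C);
      auto with s3. }
  assert (E' : pairing (poisson f g) h = (- (1) * pairing (poisson g f) h)%C).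
  { rewrite <- pairing_scall by auto with s3. apply pairing_ext; [| easy].
    intros l u _. rewrite poisson_antisym. ring. }
  rewrite E'. transitivity (pairing f (poisson g h) - (pairing (poisson g f) h + pairing f
      (poisson g h)))%C; [ring |].
  rewrite E. ring.
Qed.

Lemma pairing_laplacian f h : smooth_S2 f -> smooth_S2 h ->
  pairing (laplacian f) h = pairing f (laplacian h).
Proof.
  intros (F1 & F2 & RF)%smooth_represents (H1 & H2 & RH)%smooth_represents.
  rewrite !pairingE.
  rewrite (sint_represents _ _ _ (represents_mul _ _ _ _ _ _ (represents_laplacian _ _ _ RF)
      RH)).
  rewrite (sint_represents _ _ _ (represents_mul _ _ _ _ _ _ RF (represents_laplacian _ _ _
      RH))).
  destruct RF as (? & ? & _), RH as (? & ? & _).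
  assert (S : forall A B, smooth3 A -> smooth3 B -> sphere_int (fmul (lapS A) B) = sphere_int
      (fmul A (lapS B))).
  { intros A B HA HB. apply Rminus_diag_uniq.
    rewrite <- sphere_int_sub by auto with s3. now apply sphere_int_lapS. }
  rewrite !sphere_int_sub, !sphere_int_add, !S by auto with s3. reflexivity.
Qed.

(** * Legendre functions *)

(** Infinitely differentiable functions on R. *)
Definition smooth1 (v : R -> R) := forall n t, ex_derive (Derive_n v n) t.

Lemma is_derive_Derive_n v n t : smooth1 v -> is_derive (Derive_n v n) t (Derive_n v (S n) t).
Proof. intros H. exact (Derive_correct _ _ (H n t)). Qed.

(** The Leibniz expansion of the n-th derivative of (t^2 - 1) v.  The truncated
    indices n - 1 and n - 2 only matter where their coefficients are nonzero. *)
Definition quad_leibniz (v : R -> R) n t :=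
  (t ^ 2 - 1) * Derive_n v n t + 2 * INR n * t * Derive_n v (n - 1) t
  + INR n * (INR n - 1) * Derive_n v (n - 2) t.

Lemma is_derive_quad_leibniz v n t : smooth1 v ->
  is_derive (quad_leibniz v n) t (quad_leibniz v (S n) t).
Proof.
  intros Hv.
  assert (D := fun n => is_derive_Derive_n v n t Hv).
  evar_last.
  - unfold quad_leibniz. auto_derive; [repeat split; apply Hv | reflexivity].
  - assert (E : forall n, Derive (fun x => Derive_n v n x) t = Derive_n v (S n) t) by
      reflexivity.
    rewrite !E. unfold quad_leibniz.
    destruct n as [|[|n]].
    + simpl. ring.
    + simpl. ring.
    + replace (S (S n) - 1)%nat with (S n) by lia.
      replace (S (S n) - 2)%nat with n by lia.
      replace (S (S (S n)) - 1)%nat with (S (S n)) by lia.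
      replace (S (S (S n)) - 2)%nat with (S n) by lia.
      rewrite !S_INR. ring.
Qed.

Lemma Derive_n_quad v n t : smooth1 v ->
  Derive_n (fun t => (t ^ 2 - 1) * v t) n t = quad_leibniz v n t.
Proof.
  intros Hv. revert t; induction n as [|n IH]; intros t.
  - unfold quad_leibniz. simpl. ring.
  - simpl. rewrite (Derive_ext _ _ _ IH). now apply is_derive_unique, is_derive_quad_leibniz.
Qed.

Definition rodrigues (l : nat) (t : R) : R := (t ^ 2 - 1) ^ l.

Lemma smooth1_rodrigues l : smooth1 (rodrigues l).
Proof.
  induction l as [|l IH]; intros n t.
  - apply ex_derive_ext with (fun _ => match n with O => 1 | _ => 0 end);
      [| apply ex_derive_const].
    intros u. destruct n as [|n]; [reflexivity |].
    symmetry. unfold rodrigues; simpl pow. apply (Derive_n_const n 1).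
  - apply ex_derive_ext with (quad_leibniz (rodrigues l) n).
    + intros u; symmetry. now apply Derive_n_quad.
    + eexists; now apply is_derive_quad_leibniz.
Qed.

Lemma rodrigues_top l t : Derive_n (rodrigues l) (2 * l) t = INR (fact (2 * l)).
Proof.
  revert t; induction l as [|l IH]; intros t; [simpl; reflexivity |].
  rewrite (Derive_n_quad (rodrigues l)) by apply smooth1_rodrigues.
  assert (E1 : forall u, Derive_n (rodrigues l) (S (2 * l)) u = 0).
  { intros u. simpl. rewrite (Derive_ext _ _ _ IH). apply Derive_const. }
  assert (E2 : forall u, Derive_n (rodrigues l) (S (S (2 * l))) u = 0).
  { intros u. change (Derive (Derive_n (rodrigues l) (S (2 * l))) u = 0).
    rewrite (Derive_ext _ _ _ E1). apply Derive_const. }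
  unfold quad_leibniz.
  replace (2 * S l)%nat with (S (S (2 * l))) by lia.
  replace (S (S (2 * l)) - 1)%nat with (S (2 * l)) by lia.
  replace (S (S (2 * l)) - 2)%nat with (2 * l)%nat by lia.
  rewrite E1, E2, IH.
  change (fact (S (S (2 * l)))) with (S (S (2 * l)) * (S (2 * l) * fact (2 * l)))%nat.
  rewrite !mult_INR, !S_INR. ring.
Qed.

(** The (n+1)-st derivative of (t^2 - 1) w' = 2 l t w, for w = (t^2 - 1)^l. *)
Lemma rodrigues_ode l n t :
  (t ^ 2 - 1) * Derive_n (rodrigues l) (S (S n)) t
  + 2 * (INR n + 1) * t * Derive_n (rodrigues l) (S n) t
  + INR n * (INR n + 1) * Derive_n (rodrigues l) n t =
  2 * INR l * (t * Derive_n (rodrigues l) (S n) t + (INR n + 1) * Derive_n (rodrigues l) n t).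
Proof.
  pose proof (smooth1_rodrigues l) as Hw.
  set (W := Derive_n (rodrigues l)).
  assert (E : forall n t, Derive (fun x => W n x) t = W (S n) t) by reflexivity.
  assert (D : forall n t, ex_derive (fun x => W n x) t) by (intros; apply Hw).
  revert t; induction n as [|n IH]; intros t.
  - assert (E0 : forall u, (u ^ 2 - 1) * W 1%nat u = 2 * INR l * u * W 0%nat u).
    { intros u. change (W 1%nat u) with (Derive (rodrigues l) u). change (W 0%nat u) with
        (rodrigues l u).
      rewrite (is_derive_unique (rodrigues l) u (INR l * (2 * u) * (u ^ 2 - 1) ^ pred l)).
      - unfold rodrigues. destruct l as [|l]; [simpl; ring |]. simpl pred. simpl pow. ring.
      - unfold rodrigues. auto_derive; trivial. replace (u * (u * 1) + - (1)) with (u ^ 2 - 1)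
          by ring. ring. }
    assert (E1 : Derive (fun u => (u ^ 2 - 1) * W 1%nat u) t = Derive (fun u => 2 * INR l * u *
        W 0%nat u) t)
      by (apply Derive_ext, E0).
    rewrite (is_derive_unique _ t (2 * t * W 1%nat t + (t ^ 2 - 1) * W 2%nat t)) in E1.
    + rewrite (is_derive_unique _ t (2 * INR l * (W 0%nat t + t * W 1%nat t))) in E1.
      * change (INR 0) with 0. lra.
      * auto_derive; [apply D | rewrite E; ring].
    + auto_derive; [apply D | rewrite E; ring].
  - pose proof (Derive_ext _ _ t IH) as E1.
    rewrite (is_derive_unique _ t (2 * t * W (S (S n)) t + (t ^ 2 - 1) * W (S (S (S n))) t
      + 2 * (INR n + 1) * (W (S n) t + t * W (S (S n)) t) + INR n * (INR n + 1) * W (S n) t))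
          in E1.
    + rewrite (is_derive_unique _ t (2 * INR l * (W (S n) t + t * W (S (S n)) t + (INR n + 1) *
        W (S n) t))) in E1.
      * rewrite S_INR. lra.
      * auto_derive; [repeat split; apply D | rewrite !E; ring].
    + auto_derive; [repeat split; apply D | rewrite !E; ring].
Qed.

(** The k-th derivative of the Legendre polynomial P_l, multiplied by 2^l l!. *)
Definition leg (l k : nat) : R -> R := Derive_n (rodrigues l) (l + k).

Lemma is_derive_leg l k t : is_derive (leg l k) t (leg l (S k) t).
Proof.
  unfold leg. rewrite Nat.add_succ_r. apply is_derive_Derive_n, smooth1_rodrigues.
Qed.

(** The differential equation of the associated Legendre functions. *)
Lemma leg_ode l k t :
  (1 - t ^ 2) * leg l (S (S k)) t =
  2 * (INR k + 1) * t * leg l (S k) t - (INR l - INR k) * (INR l + INR k + 1) * leg l k t.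
Proof.
  pose proof (rodrigues_ode l (l + k) t) as H. unfold leg.
  rewrite !Nat.add_succ_r, plus_INR in *. lra.
Qed.

Lemma leg_top l t : leg l l t = INR (fact (2 * l)).
Proof. unfold leg. replace (l + l)%nat with (2 * l)%nat by lia. apply rodrigues_top. Qed.

Lemma RInt_FTC (f df : R -> R) a b : (forall t, is_derive f t (df t)) -> (forall t, continuous
    df t) ->
  RInt df a b = f b - f a.
Proof.
  intros H C. apply is_RInt_unique. apply (is_RInt_derive f df); auto.
Qed.

Lemma continuous_weight k t : continuous (fun t => (1 - t ^ 2) ^ k) t.
Proof. apply (ex_derive_continuous (V := R_NormedModule)). auto_derive; trivial. Qed.

Lemma continuous_leg_sq l k t : continuous (fun t => (1 - t ^ 2) ^ k * leg l k t ^ 2) t.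
Proof.
  apply (continuous_mult (K := R_AbsRing)); [apply continuous_weight |].
  apply (ex_derive_continuous (V := R_NormedModule)). auto_derive. repeat split.
  eexists; apply is_derive_leg.
Qed.

Lemma ex_RInt_leg_sq l k : ex_RInt (fun t => (1 - t ^ 2) ^ k * leg l k t ^ 2) (-1) 1.
Proof.
  apply (ex_RInt_continuous (V := R_CompleteNormedModule)). intros; apply continuous_leg_sq.
Qed.

Lemma weight_int l : RInt (fun t => (1 - t ^ 2) ^ l) (-1) 1
  = 2 ^ (2 * l + 1) * INR (fact l) ^ 2 / INR (fact (2 * l + 1)).
Proof.
  induction l as [|l IH].
  - simpl. rewrite RInt_const. unfold scal; simpl; unfold mult; simpl. field.
  - assert (E : forall k, ex_RInt (fun t => (1 - t ^ 2) ^ k) (-1) 1).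
    { intros; apply (ex_RInt_continuous (V := R_CompleteNormedModule)). intros; apply
        continuous_weight. }
    (* The integrand is the derivative of t (1 - t^2)^(l+1). *)
    assert (H : RInt (fun t => plus (scal (2 * INR l + 3) ((1 - t ^ 2) ^ S l)) (scal (- 2 *
        (INR l + 1)) ((1 - t ^ 2) ^ l))) (-1) 1 = 0).
    { rewrite (RInt_FTC (fun t => t * (1 - t ^ 2) ^ S l)).
      - simpl. ring.
      - intros t. evar_last; [auto_derive; [trivial | reflexivity] |].
        change (1 * ((1 + - (t * (t * 1))) * (1 + - (t * (t * 1))) ^ l) + t * (- (1 * ((1 + 1)
            * (t * 1))) *
          (INR (S l) * (1 + - (t * (t * 1))) ^ l)) =
          (2 * INR l + 3) * ((1 - t ^ 2) * (1 - t ^ 2) ^ l) + - 2 * (INR l + 1) * (1 - t ^ 2) ^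
              l).
        replace (1 + - (t * (t * 1))) with (1 - t ^ 2) by ring.
        rewrite S_INR. ring.
      - intros t. apply (continuous_plus (V := R_NormedModule)); apply (continuous_scal_r (V :=
          R_NormedModule));
          apply continuous_weight. }
    rewrite (RInt_plus (V := R_CompleteNormedModule)) in H
      by (apply (ex_RInt_scal (V := R_CompleteNormedModule)); apply E).
    rewrite !(RInt_scal (V := R_CompleteNormedModule)) in H by apply E.
    change ((2 * INR l + 3) * RInt (fun t => (1 - t ^ 2) ^ S l) (-1) 1
      + - 2 * (INR l + 1) * RInt (fun t => (1 - t ^ 2) ^ l) (-1) 1 = 0) in H.
    rewrite IH in H.
    apply Rmult_eq_reg_l with (2 * INR l + 3); [| pose proof (pos_INR l); lra].
    replace (2 * S l + 1)%nat with (S (S (2 * l + 1))) by lia.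
    change (fact (S (S (2 * l + 1)))) with (S (S (2 * l + 1)) * (S (2 * l + 1) * fact (2 * l +
        1)))%nat.
    change (fact (S l)) with (S l * fact l)%nat.
    rewrite !mult_INR, !S_INR, plus_INR, mult_INR.
    change (INR 2) with 2; change (INR 1) with 1.
    pose proof (INR_fact_neq_0 (2 * l + 1)). pose proof (pos_INR l).
    match type of H with ?a + ?b = 0 => transitivity (- b); [lra |] end.
    replace (2 ^ S (S (2 * l + 1))) with (2 * (2 * 2 ^ (2 * l + 1))) by (simpl; ring).
    field. repeat split; lra.
Qed.

(** Integration by parts, using [leg_ode]. *)
Lemma leg_int_step l k :
  RInt (fun t => (1 - t ^ 2) ^ S k * leg l (S k) t ^ 2) (-1) 1 =
  (INR l - INR k) * (INR l + INR k + 1) * RInt (fun t => (1 - t ^ 2) ^ k * leg l k t ^ 2) (-1)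
      1.
Proof.
  assert (H : RInt (fun t => plus ((1 - t ^ 2) ^ S k * leg l (S k) t ^ 2)
     (scal (- ((INR l - INR k) * (INR l + INR k + 1))) ((1 - t ^ 2) ^ k * leg l k t ^ 2))) (-1)
         1 = 0).
  { rewrite (RInt_FTC (fun t => (1 - t ^ 2) ^ S k * leg l (S k) t * leg l k t)).
    - simpl. ring.
    - intros t. evar_last.
      + auto_derive; [repeat split; eexists; apply is_derive_leg | reflexivity].
      + rewrite !(is_derive_unique _ _ _ (is_derive_leg l _ t)).
        pose proof (leg_ode l k t) as O.
        transitivity ((1 - t ^ 2) ^ k * leg l k t * ((1 - t ^ 2) * leg l (S (S k)) t - 2 * (INR
            k + 1) * t * leg l (S k) t)
          + (1 - t ^ 2) ^ S k * leg l (S k) t ^ 2).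
        * change (match k with 0%nat => 1 | S _ => INR k + 1 end) with (INR (S k)).
          replace (1 + - (t * (t * 1))) with (1 - t ^ 2) by ring.
          change ((1 - t ^ 2) ^ S k) with ((1 - t ^ 2) * (1 - t ^ 2) ^ k).
          rewrite S_INR. ring.
        * rewrite O. unfold plus, scal; simpl; unfold mult; simpl. ring.
    - intros t. apply (continuous_plus (V := R_NormedModule)); [apply continuous_leg_sq |].
      apply (continuous_scal_r (V := R_NormedModule)), continuous_leg_sq. }
  rewrite (RInt_plus (V := R_CompleteNormedModule)) in H;
    [| apply ex_RInt_leg_sq | apply (ex_RInt_scal (V := R_CompleteNormedModule)),
        ex_RInt_leg_sq].
  rewrite (RInt_scal (V := R_CompleteNormedModule)) in H by apply ex_RInt_leg_sq.
  change (RInt (fun t => (1 - t ^ 2) ^ S k * leg l (S k) t ^ 2) (-1) 1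
    + - ((INR l - INR k) * (INR l + INR k + 1)) * RInt (fun t => (1 - t ^ 2) ^ k * leg l k t ^
        2) (-1) 1 = 0) in H.
  lra.
Qed.

(** The norms of the associated Legendre functions, by descending induction on k
    from k = l, where [leg l l] is constant. *)
Lemma leg_int l k : (k <= l)%nat ->
  RInt (fun t => (1 - t ^ 2) ^ k * leg l k t ^ 2) (-1) 1
  = 2 * (2 ^ l * INR (fact l)) ^ 2 * INR (fact (l + k)) / ((2 * INR l + 1) * INR (fact (l -
      k))).
Proof.
  intros Hk. pose proof (pos_INR l).
  remember (l - k)%nat as d eqn:Hd. revert k Hk Hd.
  induction d as [|d IH]; intros k Hk Hd.
  - assert (k = l) as -> by lia.
    rewrite (RInt_ext (V := R_CompleteNormedModule) _ (fun t => scal (INR (fact (2 * l)) ^ 2)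
        ((1 - t ^ 2) ^ l))).
    + rewrite (RInt_scal (V := R_CompleteNormedModule)).
      2:{ apply (ex_RInt_continuous (V := R_CompleteNormedModule)). intros; apply
          continuous_weight. }
      rewrite weight_int.
      replace (l + l)%nat with (2 * l)%nat by lia.
      replace (2 * l + 1)%nat with (S (2 * l)) by lia.
      change (fact (S (2 * l))) with (S (2 * l) * fact (2 * l))%nat.
      rewrite mult_INR, S_INR, mult_INR. change (INR 2) with 2.
      match goal with |- scal ?a ?b = ?c => change (a * b = c) end.
      change (2 ^ S (2 * l)) with (2 * 2 ^ (2 * l)). rewrite pow_mult.
      replace ((2 ^ 2) ^ l) with (2 ^ l * 2 ^ l) by (rewrite <- Rpow_mult_distr; f_equal; ring).
      pose proof (INR_fact_neq_0 (2 * l)). 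
      change (fact 0) with 1%nat. change (INR 1) with 1. field. repeat split; lra.
    + intros t _. rewrite leg_top.
      match goal with |- ?c = scal ?a ?b => change (c = a * b) end. ring.
  - pose proof (IH (S k) ltac:(lia) ltac:(lia)) as E. rewrite leg_int_step in E.
    assert (Hlk : INR l - INR k = INR d + 1).
    { rewrite <- minus_INR, <- Hd by lia. apply S_INR. }
    rewrite Hlk in E.
    replace (l + S k)%nat with (S (l + k)) in E by lia.
    change (fact (S (l + k))) with (S (l + k) * fact (l + k))%nat in E.
    change (fact (S d)) with (S d * fact d)%nat.
    rewrite mult_INR, S_INR, plus_INR in E. rewrite mult_INR, S_INR.
    pose proof (pos_INR d). pose proof (pos_INR k).
    pose proof (INR_fact_neq_0 d).
    apply Rmult_eq_reg_l with ((INR d + 1) * (INR l + INR k + 1)); [| nra].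
    rewrite E. field. repeat split; lra.
Qed.

(** * Spherical harmonics *)

(** A smooth function of the height alone is smooth on R^3. *)
Lemma smooth3_height v : smooth1 v -> smooth3 (fun p => v (cz p)).
Proof.
  intros Hv.
  assert (H : forall k n, times_differentiable k (fun p => Derive_n v n (cz p))).
  { induction k as [|k IH]; intros n; [exact I |].
    assert (Z : forall j, times_differentiable j (fcst 0)) by (intros; apply smooth3_cst).
    assert (E1 : pd1 (fun p => Derive_n v n (cz p)) = fcst 0).
    { pd_ext. exact (is_derive_cstR _ _). }
    assert (E2 : pd2 (fun p => Derive_n v n (cz p)) = fcst 0).
    { pd_ext. exact (is_derive_cstR _ _). }
    assert (E3 : pd3 (fun p => Derive_n v n (cz p)) = (fun p => Derive_n v (S n) (cz p))).
    { pd_ext. exact (is_derive_Derive_n v n z Hv). }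
    split; [| rewrite E1, E2, E3; repeat split; auto].
    intros p. eexists.
    apply (filterdiff_comp' (K := R_AbsRing) cz (Derive_n v n) p cz).
    - apply filterdiff_linear, is_linear_snd.
    - exact (is_derive_Derive_n v n (cz p) Hv). }
  intros k; exact (H k 0%nat).
Qed.

(** The function x + i s y on the sphere; s will be a sign. *)
Definition cis (s : R) (l u : R) : C :=
  (sqrt (1 - u ^ 2) * cos l, sqrt (1 - u ^ 2) * (s * sin l)).

Fixpoint cis_pow (s : R) (k : nat) (l u : R) : C :=
  match k with O => RtoC 1 | S k => (cis s l u * cis_pow s k l u)%C end.

Lemma smooth_cis_pow s k : smooth_S2 (cis_pow s k).
Proof.
  induction k as [|k IH]; [apply (smooth_cst (RtoC 1)) |].
  apply (smooth_mul (cis s) (cis_pow s k)); trivial.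
  apply (represents_smooth _ cx (fmul (fcst s) cy)).
  split; [|split]; auto with s3.
  intros l u _. unfold cis, fmul, fcst, cx, cy, sphere_pt; cbn [fst snd]. f_equal; ring.
Qed.

Lemma cis_powE s k l u : s * s = 1 ->
  cis_pow s k l u = (sqrt (1 - u ^ 2) ^ k * cos (s * INR k * l), sqrt (1 - u ^ 2) ^ k * sin (s
      * INR k * l)).
Proof.
  intros Hs.
  assert (E : cos (s * l) = cos l /\ sin (s * l) = s * sin l).
  { assert (s = 1 \/ s = -1) as [-> | ->].
    { assert ((s - 1) * (s + 1) = 0) as [|]%Rmult_integral by lra; [left | right]; lra. }
    - now rewrite !Rmult_1_l.
    - replace (-1 * l) with (- l) by ring. rewrite cos_neg, sin_neg; split; ring. }
  destruct E as [Ec Es].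
  induction k as [|k IH].
  - simpl. rewrite Rmult_0_r, Rmult_0_l, cos_0, sin_0. unfold RtoC. f_equal; ring.
  - change (cis_pow s (S k) l u) with (cis s l u * cis_pow s k l u)%C.
    rewrite IH, S_INR.
    replace (s * (INR k + 1) * l) with (s * l + s * INR k * l) by ring.
    rewrite cos_plus, sin_plus, Ec, Es. simpl pow.
    unfold cis, Cmult; cbn [fst snd]. f_equal; simpl; ring.
Qed.

(** m = s |m| for a sign s. *)
Lemma abs_sign m : exists s, s * s = 1 /\ IZR m = s * INR (Z.abs_nat m).
Proof.
  destruct (Z_le_gt_dec 0 m) as [H | H].
  - exists 1. rewrite INR_IZR_INZ, Zabs2Nat.id_abs, Z.abs_eq by trivial. split; ring.
  - exists (-1). rewrite INR_IZR_INZ, Zabs2Nat.id_abs, Z.abs_neq by lia. rewrite opp_IZR.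
      split; ring.
Qed.

(** The factor of Y_{lm} depending on the height. *)
Definition amp (l : nat) (m : Z) (u : R) : R := harmonic_norm l m * legendre l (Z.abs_nat m) u.

Lemma YlmE l m t u : Ylm l m t u = (amp l m u * cos (IZR m * t), amp l m u * sin (IZR m * t)).
Proof.
  unfold Ylm, Cmult, RtoC, amp; cbn [fst snd]. f_equal; ring.
Qed.

Lemma legendreE l k u :
  legendre l k u = sqrt (1 - u ^ 2) ^ k * leg l k u / (2 ^ l * INR (fact l)).
Proof. unfold legendre, leg, rodrigues. unfold Rdiv. ring. Qed.

(** Y_{lm} is a polynomial in the coordinates, as (1 - mu^2)^{|m|/2} e^{i m lambda}
    is the |m|-th power of x + i s y, with s the sign of m. *)
Lemma smooth_Ylm l m : smooth_S2 (Ylm l m).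
Proof.
  destruct (abs_sign m) as (s & Hs & Hm).
  set (k := Z.abs_nat m) in *.
  set (c := harmonic_norm l m / (2 ^ l * INR (fact l))).
  apply smooth_ext with (fun t u => RtoC c * (RtoC (leg l k u) * cis_pow s k t u))%C.
  - intros t u _. rewrite cis_powE, <- Hm, YlmE by trivial.
    unfold amp. fold k. rewrite legendreE. unfold c.
    unfold Cmult, RtoC; cbn [fst snd]. f_equal; unfold Rdiv; ring.
  - apply smooth_scal. apply (smooth_mul (fun _ u => RtoC (leg l k u)) (cis_pow s k)); [| apply
      smooth_cis_pow].
    apply (represents_smooth _ (fun p => leg l k (cz p)) (fcst 0)).
    split; [|split]; auto with s3.
    apply smooth3_height. intros n t.
    apply ex_derive_ext with (Derive_n (rodrigues l) (n + (l + k))).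
    + intros; symmetry; apply Derive_n_comp.
    + apply smooth1_rodrigues.
Qed.

Lemma is_derive_sqrt_pow k u : -1 < u < 1 ->
  is_derive (fun t => sqrt (1 - t ^ 2) ^ k) u (- INR k * u * sqrt (1 - u ^ 2) ^ k / (1 - u ^
      2)).
Proof.
  intros Hu. pose proof (interior_pos u Hu) as Hp.
  pose proof (sqrt_lt_R0 _ Hp) as Hs.
  pose proof (sqrt_sqrt (1 - u ^ 2) ltac:(lra)) as E.
  evar_last; [auto_derive; [simpl in Hp; exact Hp | reflexivity] |].
  replace (1 + - (u * (u * 1))) with (1 - u ^ 2) by ring.
  set (s := sqrt (1 - u ^ 2)) in *. rewrite <- E.
  destruct k as [|k]; [simpl; field; lra |].
  change (Init.Nat.pred (S k)) with k. change (s ^ S k) with (s * s ^ k).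
  field. lra.
Qed.

(** (1 - mu^2) times the derivative of [amp]. *)
Definition amp1 l m u :=
  harmonic_norm l m / (2 ^ l * INR (fact l)) * (sqrt (1 - u ^ 2) ^ Z.abs_nat m *
    (- INR (Z.abs_nat m) * u * leg l (Z.abs_nat m) u + (1 - u ^ 2) * leg l (S (Z.abs_nat m))
        u)).

Lemma is_derive_amp l m u : -1 < u < 1 -> is_derive (amp l m) u (amp1 l m u / (1 - u ^ 2)).
Proof.
  intros Hu. pose proof (interior_pos u Hu) as Hp.
  unfold amp1. set (k := Z.abs_nat m). set (c := harmonic_norm l m / _).
  apply is_derive_ext with (fun u => c * (sqrt (1 - u ^ 2) ^ k * leg l k u)).
  { intros t. unfold amp. fold k. rewrite legendreE. unfold c, Rdiv. simpl. ring. }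
  evar_last.
  - apply is_derive_scal. apply (is_derive_mult (fun t => sqrt (1 - t ^ 2) ^ k) (leg l k));
     [now apply is_derive_sqrt_pow | apply is_derive_leg | exact Rmult_comm].
  - match goal with |- ?a = ?b => change (@eq R a b) end.
    unfold plus, mult; cbn -[pow]. field. lra.
Qed.

Lemma is_derive_amp1 l m u : -1 < u < 1 ->
  is_derive (amp1 l m) u ((IZR m ^ 2 / (1 - u ^ 2) - lap l) * amp l m u).
Proof.
  intros Hu. pose proof (interior_pos u Hu) as Hp.
  assert (Em : IZR m ^ 2 = INR (Z.abs_nat m) ^ 2).
  { destruct (abs_sign m) as (s & Hs & ->). simpl. ring [Hs]. }
  unfold amp, amp1. rewrite Em, legendreE. set (k := Z.abs_nat m).
  pose proof (leg_ode l k u) as O.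
  evar_last.
  - apply is_derive_scal. apply (is_derive_mult (fun t => sqrt (1 - t ^ 2) ^ k)
      (fun u => - INR k * u * leg l k u + (1 - u ^ 2) * leg l (S k) u));
     [now apply is_derive_sqrt_pow | | exact Rmult_comm].
    auto_derive; [repeat split; eexists; apply is_derive_leg |].
    rewrite !(is_derive_unique _ _ _ (is_derive_leg l _ u)). reflexivity.
  - match goal with |- ?a = ?b => change (@eq R a b) end.
    unfold plus, mult; cbn -[pow].
    replace (1 + - (u * (u * 1))) with (1 - u ^ 2) by ring.
    pose proof (INR_fact_neq_0 l). pose proof (pow_lt 2 l ltac:(lra)).
    unfold lap.
    transitivity (harmonic_norm l m / (2 ^ l * INR (fact l)) * sqrt (1 - u ^ 2) ^ k *
      (INR k ^ 2 * u ^ 2 / (1 - u ^ 2) * leg l k u - INR k * u * leg l (S k) u - INR k * leg l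
          k u
       - INR k * u * leg l (S k) u - 2 * u * leg l (S k) u + (1 - u ^ 2) * leg l (S (S k)) u)).
    { field. repeat split; lra. }
    rewrite O. field. repeat split; lra.
Qed.

Lemma d_lambda_Ylm l m t u : d_lambda (Ylm l m) t u = (RtoC (IZR m) * Ci * Ylm l m t u)%C.
Proof.
  unfold d_lambda, CDer. rewrite YlmE.
  rewrite (Derive_ext _ (fun s => amp l m u * cos (IZR m * s))) by (intros; now rewrite YlmE).
  rewrite (Derive_ext (fun s => Im _) (fun s => amp l m u * sin (IZR m * s))) by (intros; now
      rewrite YlmE).
  unfold Cmult, RtoC, Ci; cbn [fst snd]. f_equal.
  - apply is_derive_unique. auto_derive; trivial. ring.
  - apply is_derive_unique. auto_derive; trivial. ring.
Qed.

Lemma laplacian_Ylm l m : eq_S2 (laplacian (Ylm l m)) (fun t u => RtoC (- lap l) * Ylm l m t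
    u)%C.
Proof.
  intros t u Hu. unfold laplacian.
  pose proof (interior_pos u Hu) as Hp.
  assert (EL : d_lambda (d_lambda (Ylm l m)) t u = (RtoC (- IZR m ^ 2) * Ylm l m t u)%C).
  { replace (d_lambda (Ylm l m)) with (fun t u => RtoC (IZR m) * Ci * Ylm l m t u)%C
      by (apply functional_extensionality; intros; apply functional_extensionality; intros;
          now rewrite d_lambda_Ylm).
    unfold d_lambda, CDer.
    rewrite (Derive_ext _ (fun s => - IZR m * amp l m u * sin (IZR m * s))).
    2:{ intros; rewrite YlmE. unfold Cmult, RtoC, Ci, Re; cbn [fst snd]; ring. }
    rewrite (Derive_ext (fun s => Im _) (fun s => IZR m * amp l m u * cos (IZR m * s))).
    2:{ intros; rewrite YlmE. unfold Cmult, RtoC, Ci, Im; cbn [fst snd]; ring. }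
    rewrite YlmE. unfold Cmult, RtoC; cbn [fst snd]. f_equal;
    apply is_derive_unique; auto_derive; trivial; ring. }
  assert (EM : forall v, -1 < v < 1 -> (RtoC (1 - v ^ 2) * d_mu (Ylm l m) t v)%C =
     (amp1 l m v * cos (IZR m * t), amp1 l m v * sin (IZR m * t))).
  { intros v Hv. pose proof (interior_pos v Hv) as Hq.
    unfold d_mu, CDer.
    rewrite (Derive_ext _ (fun s => amp l m s * cos (IZR m * t))) by (intros; now rewrite YlmE).
    rewrite (Derive_ext (fun s => Im _) (fun s => amp l m s * sin (IZR m * t))) by (intros; now
        rewrite YlmE).
    rewrite !Derive_scal_l, (is_derive_unique _ _ _ (is_derive_amp l m v Hv)).
    unfold Cmult, RtoC; cbn [fst snd]. f_equal; field; lra. }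
  assert (ED : d_mu (fun l0 u0 => RtoC (1 - u0 ^ 2) * d_mu (Ylm l m) l0 u0)%C t u =
    (RtoC (IZR m ^ 2 / (1 - u ^ 2) - lap l) * Ylm l m t u)%C).
  { rewrite YlmE. unfold d_mu at 1, CDer.
    rewrite (Derive_ext_loc _ (fun s => amp1 l m s * cos (IZR m * t))).
    2:{ generalize (locally_interior u Hu). apply filter_imp. intros v Hv. now rewrite (EM v
        Hv). }
    rewrite (Derive_ext_loc (fun s => Im _) (fun s => amp1 l m s * sin (IZR m * t))).
    2:{ generalize (locally_interior u Hu). apply filter_imp. intros v Hv. now rewrite (EM v
        Hv). }
    rewrite !Derive_scal_l, (is_derive_unique _ _ _ (is_derive_amp1 l m u Hu)).
    unfold Cmult, RtoC; cbn [fst snd]. f_equal; ring. }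
  rewrite ED, EL.
  unfold Cmult, Cplus, RtoC; cbn [fst snd]. f_equal; field; lra.
Qed.

#[local] Hint Resolve smooth_Ylm : s3.

Lemma poisson_height f l u : poisson height f l u = (- d_lambda f l u)%C.
Proof.
  unfold poisson.
  assert (E1 : d_lambda height l u = RtoC 0).
  { unfold d_lambda, CDer, height, RtoC, Re, Im; cbn [fst snd]. now rewrite !Derive_const. }
  assert (E2 : d_mu height l u = RtoC 1).
  { unfold d_mu, CDer, height, RtoC, Re, Im; cbn [fst snd].
    now rewrite Derive_const, Derive_id. }
  rewrite E1, E2. ring.
Qed.

Lemma poisson_height_Ylm l m : eq_S2 (poisson height (Ylm l m))
  (fun t u => - (RtoC (IZR m) * Ci) * Ylm l m t u)%C.
Proof. intros t u _. rewrite poisson_height, d_lambda_Ylm. ring. Qed.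

Lemma pairing_addr f h h' : smooth_S2 f -> smooth_S2 h -> smooth_S2 h' ->
  pairing f (fun l u => h l u + h' l u)%C = (pairing f h + pairing f h')%C.
Proof. intros. rewrite pairing_sym, pairing_addl, !(pairing_sym f) by trivial. reflexivity. Qed.

Lemma pairing_scalr (c : C) f h : smooth_S2 f -> smooth_S2 h ->
  pairing f (fun l u => c * h l u)%C = (c * pairing f h)%C.
Proof. intros. rewrite pairing_sym, pairing_scall, !(pairing_sym f) by trivial. reflexivity.
    Qed.

Lemma eq_S2_refl f : eq_S2 f f.
Proof. easy. Qed.

Lemma RtoC_neq r : r <> 0 -> RtoC r <> RtoC 0.
Proof. intros H E. apply H. now injection E. Qed.

Lemma Cmult_eq0 (a b : C) : (a * b)%C = RtoC 0 -> a <> RtoC 0 -> b = RtoC 0.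
Proof.
  intros E Ha. replace b with (/ a * (a * b))%C by (field; trivial).
  rewrite E. ring.
Qed.

Lemma lap_inj l l' : lap l = lap l' -> l = l'.
Proof.
  unfold lap. intros H. apply INR_eq. pose proof (pos_INR l). pose proof (pos_INR l'). nra.
Qed.

(** The Laplacian is symmetric and has different eigenvalues on the two sides. *)
Lemma pairing_Ylm_degree l m l' m' : l <> l' -> pairing (Ylm l m) (Ylm l' m') = RtoC 0.
Proof.
  intros Hl.
  assert (E : (RtoC (- lap l) * pairing (Ylm l m) (Ylm l' m'))%C = (RtoC (- lap l') * pairing
      (Ylm l m) (Ylm l' m'))%C).
  { transitivity (pairing (laplacian (Ylm l m)) (Ylm l' m')).
    - rewrite <- pairing_scall by auto with s3. symmetry.
      apply pairing_ext; [apply laplacian_Ylm | apply eq_S2_refl].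
    - rewrite pairing_laplacian by auto with s3. rewrite <- pairing_scalr by auto with s3.
      apply pairing_ext; [apply eq_S2_refl | apply laplacian_Ylm]. }
  apply (Cmult_eq0 (RtoC (- lap l) - RtoC (- lap l'))%C).
  - replace ((RtoC (- lap l) - RtoC (- lap l')) * pairing (Ylm l m) (Ylm l' m'))%C
     with (RtoC (- lap l) * pairing (Ylm l m) (Ylm l' m') - RtoC (- lap l') * pairing (Ylm l m)
         (Ylm l' m'))%C by ring.
    rewrite E. ring.
  - rewrite <- RtoC_minus. apply RtoC_neq. intros H. apply Hl, lap_inj. lra.
Qed.

(** Bracketing with the height is antisymmetric, with eigenvalues - i m and - i m'. *)
Lemma pairing_Ylm_order l m l' m' : m <> (- m')%Z -> pairing (Ylm l m) (Ylm l' m') = RtoC 0.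
Proof.
  intros Hm.
  assert (E : (RtoC (IZR m) * Ci * pairing (Ylm l m) (Ylm l' m'))%C = (- (RtoC (IZR m') * Ci) *
      pairing (Ylm l m) (Ylm l' m'))%C).
  { transitivity (pairing (poisson (Ylm l m) height) (Ylm l' m')).
    - rewrite <- pairing_scall by auto with s3. symmetry.
      apply pairing_ext; [| apply eq_S2_refl].
      intros t u Hu. rewrite poisson_antisym, (poisson_height_Ylm l m t u Hu). ring.
    - rewrite pairing_poisson by auto with s3. rewrite <- pairing_scalr by auto with s3.
      apply pairing_ext; [apply eq_S2_refl | apply poisson_height_Ylm]. }
  apply (Cmult_eq0 (RtoC (IZR (m + m')) * Ci)%C).
  - rewrite plus_IZR, RtoC_plus.
    replace ((RtoC (IZR m) + RtoC (IZR m')) * Ci * pairing (Ylm l m) (Ylm l' m'))%C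
     with (RtoC (IZR m) * Ci * pairing (Ylm l m) (Ylm l' m') - (- (RtoC (IZR m') * Ci) *
         pairing (Ylm l m) (Ylm l' m')))%C by ring.
    rewrite E. ring.
  - apply Cmult_neq_0.
    + apply RtoC_neq. apply not_0_IZR. lia.
    + intros H. injection H. lra.
Qed.

Lemma powerRZ_m1_opp m : powerRZ (-1) (- m) = powerRZ (-1) m.
Proof.
  assert (Hi : forall n, / (-1) ^ n = (-1) ^ n).
  { intros n. rewrite <- pow_inv. f_equal. field. }
  destruct m as [|p|p]; simpl; [reflexivity | apply Hi | symmetry; apply Hi].
Qed.

Lemma harmonic_norm_opp l m : (Z.abs_nat m <= l)%nat ->
  harmonic_norm l m * harmonic_norm l (- m) =
  powerRZ (-1) m * ((2 * INR l + 1) / (4 * PI) *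
     (INR (fact (l - Z.abs_nat m)) / INR (fact (l + Z.abs_nat m)))).
Proof.
  intros Hm. unfold harmonic_norm.
  replace (Z.abs_nat (- m)) with (Z.abs_nat m) by lia.
  set (A := (2 * INR l + 1) / (4 * PI) * _).
  assert (HA : 0 <= A).
  { unfold A. pose proof (pos_INR l). pose proof PI_RGT_0.
    apply Rmult_le_pos; left; apply Rdiv_lt_0_compat; try lra; apply INR_fact_lt_0. }
  pose proof (sqrt_sqrt A HA) as E.
  assert (Hs : (if Z.leb 0 m then powerRZ (-1) m else 1) * (if Z.leb 0 (- m) then powerRZ (-1)
      (- m) else 1)
    = powerRZ (-1) m).
  { pose proof (powerRZ_m1_opp m) as Hn.
    destruct (Z.leb_spec 0 m), (Z.leb_spec 0 (- m)); try lia; rewrite ?Hn; try ring.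
    assert (m = 0)%Z as -> by lia. simpl; ring. }
  match type of Hs with ?x * ?y = _ =>
    transitivity (x * y * (sqrt A * sqrt A)); [ring | now rewrite Hs, E] end.
Qed.

Lemma pairing_Ylm_norm l m : (Z.abs m <= Z.of_nat l)%Z ->
  pairing (Ylm l m) (Ylm l (- m)) = RtoC (powerRZ (-1) m).
Proof.
  intros Hm. set (k := Z.abs_nat m). assert (Hk : (k <= l)%nat) by (unfold k; lia).
  pose proof PI_RGT_0 as HPI. pose proof (INR_fact_lt_0 l) as Hl. pose proof (pow_lt 2 l
      ltac:(lra)) as H2.
  set (c := harmonic_norm l m * harmonic_norm l (- m) / (2 ^ l * INR (fact l)) ^ 2).
  set (w := fun u => (1 - u ^ 2) ^ k * leg l k u ^ 2).
  assert (HI : is_RInt (V := C_R_CompleteNormedModule)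
     (fun u => RtoC (2 * PI * c * w u)) (-1) 1 (RtoC (2 * PI * c * RInt w (-1) 1))).
  { apply (is_RInt_fct_extend_pair (U := R_NormedModule) (V := R_NormedModule)).
    - cbn [fst RtoC]. apply (is_RInt_scal (V := R_NormedModule) w).
      apply (RInt_correct (V := R_CompleteNormedModule)), ex_RInt_leg_sq.
    - cbn [snd RtoC]. evar_last; [apply (is_RInt_const (V := R_NormedModule)) |].
      unfold scal; simpl; unfold mult; simpl; ring. }
  transitivity (RtoC (2 * PI * c * RInt w (-1) 1)).
  - rewrite <- (is_RInt_unique _ _ _ _ HI). unfold pairing.
    apply (RInt_ext (V := C_R_CompleteNormedModule)). intros u Hu.
    rewrite Rmin_left, Rmax_right in Hu by lra.
    rewrite (RInt_ext (V := C_R_CompleteNormedModule) _ (fun _ => RtoC (c * w u))).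
    + rewrite RInt_const. unfold scal; simpl. unfold prod_scal, scal; simpl. unfold mult; simpl.
      unfold RtoC; f_equal; ring.
    + intros t _. rewrite !YlmE. unfold amp. replace (Z.abs_nat (- m)) with (Z.abs_nat m) by
        lia. fold k. rewrite legendreE.
      rewrite opp_IZR. replace (- IZR m * t) with (- (IZR m * t)) by ring.
      rewrite cos_neg, sin_neg.
      pose proof (sin2_cos2 (IZR m * t)) as T. unfold Rsqr in T.
      pose proof (interior_pos u Hu) as Hp.
      assert (S : sqrt (1 - u ^ 2) ^ k * sqrt (1 - u ^ 2) ^ k = (1 - u ^ 2) ^ k).
      { rewrite <- Rpow_mult_distr, sqrt_sqrt by lra. reflexivity. }
      unfold c, w. rewrite <- S.
      unfold Cmult, RtoC; cbn [fst snd]. f_equal.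
      * set (sn := sin (IZR m * t)) in *. set (cs := cos (IZR m * t)) in *.
        transitivity (harmonic_norm l m * harmonic_norm l (- m) / (2 ^ l * INR (fact l)) ^ 2 *
          (sqrt (1 - u ^ 2) ^ k * sqrt (1 - u ^ 2) ^ k * leg l k u ^ 2) * (sn * sn + cs * cs)).
        -- field. lra.
        -- rewrite T. ring.
      * ring.
  - f_equal. unfold w. rewrite leg_int by trivial. unfold c.
    rewrite harmonic_norm_opp by trivial. fold k.
    pose proof (INR_fact_lt_0 (l - k)). pose proof (INR_fact_lt_0 (l + k)). pose proof (pos_INR
        l).
    field. repeat split; lra.
Qed.

Lemma height_Y10 : eq_S2 height (fun t u => RtoC (sqrt (4 * PI / 3)) * Ylm 1 0 t u)%C.
Proof.
  intros t u Hu. rewrite YlmE. unfold amp. rewrite legendreE.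
  assert (EL : leg 1 0 u = 2 * u).
  { change (leg 1 0 u) with (Derive (rodrigues 1) u).
    apply is_derive_unique. unfold rodrigues. auto_derive; trivial. ring. }
  change (Z.abs_nat 0) with 0%nat. rewrite EL. unfold harmonic_norm.
  pose proof PI_RGT_0 as HPI.
  assert (ES : sqrt (4 * PI / 3) * sqrt ((2 * INR 1 + 1) / (4 * PI) * (INR (fact (1 - Z.abs_nat
      0)) / INR (fact (1 + Z.abs_nat 0)))) = 1).
  { rewrite <- sqrt_mult_alt by (apply Rlt_le, Rdiv_lt_0_compat; lra).
    match goal with |- sqrt ?x = 1 => replace x with 1; [apply sqrt_1 |] end. simpl. field.
        lra. }
  rewrite Rmult_0_l, cos_0, sin_0. unfold height, Cmult, RtoC; cbn [fst snd].
  f_equal; [| ring].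
  match goal with |- _ = ?a * _ - _ => set (A := a) in * end.
  match type of ES with _ * ?b = _ => set (B := b) in * end.
  simpl. transitivity ((A * B) * u); [rewrite ES; ring |]. field.
Qed.

(** * Finite sums over degrees and orders *)

(** Sum of complex numbers over the indices 0, ..., n. *)
Definition csum (a : nat -> C) (n : nat) : C := sum_n (G := C_AbelianMonoid) a n.

Lemma csum_S (a : nat -> C) n : csum a (S n) = (csum a n + a (S n))%C.
Proof. apply (sum_Sn (G := C_AbelianMonoid)). Qed.

Lemma csum_O (a : nat -> C) : csum a 0 = a 0%nat.
Proof. apply (sum_O (G := C_AbelianMonoid)). Qed.

Lemma csum_ext (a b : nat -> C) n : (forall k, (k <= n)%nat -> a k = b k) -> csum a n = csum b
    n.
Proof. apply (sum_n_ext_loc (G := C_AbelianMonoid)). Qed.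

Lemma csum_add (a b : nat -> C) n : csum (fun k => a k + b k)%C n = (csum a n + csum b n)%C.
Proof.
  induction n as [|n IH]; [now rewrite !csum_O |]. rewrite !csum_S, IH. ring.
Qed.

Lemma csum_scal (c : C) (a : nat -> C) n : csum (fun k => c * a k)%C n = (c * csum a n)%C.
Proof.
  induction n as [|n IH]; [now rewrite !csum_O |]. rewrite !csum_S, IH. ring.
Qed.

Lemma csum_zero (a : nat -> C) n : (forall k, (k <= n)%nat -> a k = RtoC 0) -> csum a n = RtoC
    0.
Proof.
  induction n as [|n IH]; intros H; [rewrite csum_O; auto |].
  rewrite csum_S, IH, H by auto. ring.
Qed.

Lemma csum_single (a : nat -> C) n k : (k <= n)%nat ->
  (forall j, (j <= n)%nat -> j <> k -> a j = RtoC 0) -> csum a n = a k.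
Proof.
  induction n as [|n IH]; intros Hk H.
  - rewrite csum_O. f_equal; lia.
  - rewrite csum_S. destruct (Nat.eq_dec k (S n)) as [-> | Hn].
    + rewrite csum_zero; [ring |]. intros j Hj. apply H; lia.
    + rewrite IH, (H (S n)) by (try lia; intros; apply H; lia). ring.
Qed.

Lemma csum_shift (a : nat -> C) n : csum a (S n) = (a 0%nat + csum (fun k => a (S k)) n)%C.
Proof.
  induction n as [|n IH]; [now rewrite csum_S, !csum_O |].
  rewrite csum_S, IH, (csum_S (fun k => a (S k))). ring.
Qed.

Lemma csum_rev (a : nat -> C) n : csum (fun k => a (n - k)%nat) n = csum a n.
Proof.
  revert a; induction n as [|n IH]; intros a; [now rewrite !csum_O |].
  rewrite csum_S, Nat.sub_diag, csum_shift.
  rewrite <- (IH (fun k => a (S k))).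
  rewrite (csum_ext (fun k => a (S n - k)%nat) (fun k => a (S (n - k)))) by (intros; f_equal;
      lia).
  ring.
Qed.

Lemma csum_stable (a : nat -> C) N M : (N <= M)%nat -> (forall k, (N < k)%nat -> a k = RtoC 0)
    ->
  csum a M = csum a N.
Proof.
  intros HM H. induction HM as [|M HM IH]; trivial.
  rewrite csum_S, IH, H by lia. ring.
Qed.

Lemma CSeries_finite (a : nat -> C) N : (forall k, (N < k)%nat -> a k = RtoC 0) -> CSeries a =
    csum a N.
Proof.
  intros H.
  assert (P : forall p : C -> R, (forall x y : C, p (x + y)%C = p x + p y) -> p (RtoC 0) = 0 ->
     Series (fun n => p (a n)) = p (csum a N)).
  { intros p Hp P0. apply is_series_unique.
    assert (E : forall n, sum_n (fun n => p (a n)) n = p (csum a n)).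
    { induction n as [|n IH]; [now rewrite sum_O, csum_O |].
      rewrite sum_Sn, csum_S, IH, Hp. reflexivity. }
    apply (filterlim_ext_loc (fun _ => p (csum a N))).
    - exists N. intros n Hn. rewrite E. now rewrite (csum_stable a N n).
    - apply filterlim_const. }
  unfold CSeries. rewrite (P Re), (P Im) by (intros; reflexivity).
  now destruct (csum a N).
Qed.

Section Sums.
Variable alpha : R.

(** Families that vanish for all large degrees. *)
Definition fin_supp (F : nat -> Z -> C) : Prop :=
  exists L : nat, forall l m, admissible alpha l m -> (L < l)%nat -> F l m = RtoC 0.

(** Sum over the orders of the k-th admissible degree. *)
Definition level (F : nat -> Z -> C) (k : nat) : C :=
  let l := (lmin alpha + k)%nat in
  csum (fun j => F l (Z.of_nat j - Z.of_nat l)%Z) (2 * l).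

(** Sum over the first N + 1 admissible degrees. *)
Definition bounded_sum (F : nat -> Z -> C) (N : nat) : C := csum (level F) N.

Lemma level_ext F H k : (forall l m, admissible alpha l m -> F l m = H l m) -> level F k =
    level H k.
Proof. intros E. apply csum_ext. intros j Hj. apply E. split; lia. Qed.

Lemma sum_lm_ext F H : (forall l m, admissible alpha l m -> F l m = H l m) ->
  sum_lm alpha F = sum_lm alpha H.
Proof.
  intros E. change (CSeries (level F) = CSeries (level H)). f_equal.
  apply functional_extensionality; intros k. now apply level_ext.
Qed.

Lemma sum_lm_bounded F : fin_supp F -> exists N0, forall N, (N0 <= N)%nat -> sum_lm alpha F =
    bounded_sum F N.
Proof.
  intros [L HL]. exists L. intros N HN. change (CSeries (level F) = csum (level F) N).
  apply CSeries_finite. intros k Hk. apply csum_zero. intros j Hj. apply HL; [split |]; lia.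
Qed.

Lemma sum_lm_add F H : fin_supp F -> fin_supp H ->
  sum_lm alpha (fun l m => F l m + H l m)%C = (sum_lm alpha F + sum_lm alpha H)%C.
Proof.
  intros HF HH.
  assert (HFH : fin_supp (fun l m => F l m + H l m)%C).
  { destruct HF as [L1 H1], HH as [L2 H2]. exists (Nat.max L1 L2). intros l m Hlm Hl.
    rewrite H1, H2 by (trivial; lia). ring. }
  destruct (sum_lm_bounded _ HF) as [N1 E1], (sum_lm_bounded _ HH) as [N2 E2],
    (sum_lm_bounded _ HFH) as [N3 E3].
  set (N := (N1 + N2 + N3)%nat).
  rewrite (E1 N), (E2 N), (E3 N) by lia.
  unfold bounded_sum. rewrite <- csum_add. apply csum_ext. intros k _.
  unfold level. now rewrite <- csum_add.
Qed.

Lemma fin_supp_mull (H F : nat -> Z -> C) : fin_supp F -> fin_supp (fun l m => H l m * F l m)%C.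
Proof. intros [L E]. exists L. intros l m Hlm Hl. rewrite E by trivial. ring. Qed.

Lemma fin_supp_mulr (H F : nat -> Z -> C) : fin_supp F -> fin_supp (fun l m => F l m * H l m)%C.
Proof. intros [L E]. exists L. intros l m Hlm Hl. rewrite E by trivial. ring. Qed.

Lemma fin_supp_add F H : fin_supp F -> fin_supp H -> fin_supp (fun l m => F l m + H l m)%C.
Proof.
  intros [L1 H1] [L2 H2]. exists (Nat.max L1 L2). intros l m Hlm Hl.
  rewrite H1, H2 by (trivial; lia). ring.
Qed.

Lemma sum_lm_scal c F : fin_supp F -> sum_lm alpha (fun l m => c * F l m)%C = (c * sum_lm alpha
    F)%C.
Proof.
  intros HF.
  destruct (sum_lm_bounded _ HF) as [N1 E1], (sum_lm_bounded _ (fin_supp_mull (fun _ _ => c) _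
      HF)) as [N2 E2].
  rewrite (E1 (N1 + N2)%nat), (E2 (N1 + N2)%nat) by lia.
  unfold bounded_sum. rewrite <- csum_scal. apply csum_ext. intros k _.
  unfold level. now rewrite <- csum_scal.
Qed.

Lemma sum_lm_single F l0 m0 : admissible alpha l0 m0 ->
  (forall l m, admissible alpha l m -> ~ (l = l0 /\ m = m0) -> F l m = RtoC 0) ->
  sum_lm alpha F = F l0 m0.
Proof.
  intros [Hl Hm] H.
  assert (HF : fin_supp F) by (exists l0; intros; apply H; trivial; lia).
  destruct (sum_lm_bounded _ HF) as [N E].
  rewrite (E (N + l0)%nat) by lia. unfold bounded_sum.
  rewrite (csum_single _ _ (l0 - lmin alpha)); [| lia |].
  2:{ intros k Hk Hk'; apply csum_zero; intros j Hj; apply H; [split |]; lia. }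
  unfold level. replace (lmin alpha + (l0 - lmin alpha))%nat with l0 by lia.
  rewrite (csum_single _ _ (Z.to_nat (m0 + Z.of_nat l0))); [f_equal; lia | lia |].
  intros j Hj Hj'. apply H; [split |]; lia.
Qed.

Lemma sum_lm_opp_order F : sum_lm alpha (fun l m => F l (- m)%Z) = sum_lm alpha F.
Proof.
  change (CSeries (level (fun l m => F l (- m)%Z)) = CSeries (level F)). f_equal.
  apply functional_extensionality; intros k. unfold level.
  set (l := (lmin alpha + k)%nat). rewrite <- csum_rev. apply csum_ext. intros j Hj. f_equal.
      lia.
Qed.

Lemma smooth_csum (h : nat -> R -> R -> C) N : (forall k, smooth_S2 (h k)) ->
  smooth_S2 (fun t u => csum (fun k => h k t u) N).
Proof.
  intros Hh. induction N as [|N IH].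
  - apply smooth_ext with (h 0%nat); trivial. intros t u _. now rewrite csum_O.
  - apply smooth_ext with (fun t u => csum (fun k => h k t u) N + h (S N) t u)%C; [| auto with
      s3].
    intros t u _. now rewrite csum_S.
Qed.

Lemma pairing_csum (h : nat -> R -> R -> C) N f : (forall k, smooth_S2 (h k)) -> smooth_S2 f ->
  pairing (fun t u => csum (fun k => h k t u) N) f = csum (fun k => pairing (h k) f) N.
Proof.
  intros Hh Hf. induction N as [|N IH].
  - rewrite csum_O. apply pairing_ext; [| apply eq_S2_refl]. intros t u _. now rewrite csum_O.
  - rewrite csum_S, <- IH, <- pairing_addl by (auto using smooth_csum).
    apply pairing_ext; [| apply eq_S2_refl]. intros t u _. now rewrite csum_S.
Qed.

Lemma pairing_sum_lm (g : nat -> Z -> C) f : fin_supp g -> smooth_S2 f ->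
  pairing (fun t u => sum_lm alpha (fun l m => g l m * Ylm l m t u)%C) f =
  sum_lm alpha (fun l m => g l m * pairing (Ylm l m) f)%C.
Proof.
  intros [L HL] Hf.
  assert (S : forall H : nat -> Z -> C, sum_lm alpha (fun l m => g l m * H l m)%C =
     bounded_sum (fun l m => g l m * H l m)%C L).
  { intros H. apply (CSeries_finite (level (fun l m => g l m * H l m)%C)). intros k Hk.
    apply csum_zero. intros j Hj. rewrite HL by first [lia | split; lia]. ring. }
  rewrite (S (fun l m => pairing (Ylm l m) f)).
  transitivity (pairing (fun t u => bounded_sum (fun l m => g l m * Ylm l m t u)%C L) f).
  { apply pairing_ext; [| apply eq_S2_refl]. intros t u _. apply (S (fun l m => Ylm l m t u)). }
  unfold bounded_sum, level. cbv zeta.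
  rewrite pairing_csum; trivial.
  - apply csum_ext. intros k _. rewrite pairing_csum; trivial.
    + apply csum_ext. intros j _. now apply pairing_scall; auto with s3.
    + intros j. auto with s3.
  - intros k. apply smooth_csum. intros j. auto with s3.
Qed.

End Sums.

Lemma sum_lm_linear alpha (F1 F2 F3 F4 : nat -> Z -> C) (c2 c3 c4 : C) :
  fin_supp alpha F1 -> fin_supp alpha F2 -> fin_supp alpha F3 -> fin_supp alpha F4 ->
  sum_lm alpha (fun l m => (F1 l m + c2 * F2 l m) + (c3 * F3 l m + c4 * F4 l m))%C =
  ((sum_lm alpha F1 + c2 * sum_lm alpha F2) + (c3 * sum_lm alpha F3 + c4 * sum_lm alpha F4))%C.
Proof.
  intros H1 H2 H3 H4.
  pose proof (fin_supp_mull alpha (fun _ _ => c2) F2 H2) as H2'.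
  pose proof (fin_supp_mull alpha (fun _ _ => c3) F3 H3) as H3'.
  pose proof (fin_supp_mull alpha (fun _ _ => c4) F4 H4) as H4'.
  rewrite <- (sum_lm_scal alpha c2 F2 H2), <- (sum_lm_scal alpha c3 F3 H3), <- (sum_lm_scal
      alpha c4 F4 H4).
  rewrite <- (sum_lm_add alpha F1 _ H1 H2'), <- (sum_lm_add alpha _ _ H3' H4').
  apply (sum_lm_add alpha (fun l m => F1 l m + c2 * F2 l m)%C (fun l m => c3 * F3 l m + c4 * F4
      l m)%C);
    now apply fin_supp_add.
Qed.

(* From here on these are only used through their properties; unification must
   not unfold them to integrals and derivatives. *)
Local Opaque pairing poisson laplacian height Ylm.

Lemma RtoC_m1 : RtoC (-1) = (- RtoC 1)%C.
Proof. unfold RtoC, Copp; cbn [fst snd]. f_equal; ring. Qed.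

(** The eigenvalue of alpha^2 - Delta on harmonics of degree l. *)
Definition lamhat (alpha : R) (l : nat) : R := alpha ^ 2 + lap l.

Lemma lamhat_neq0 alpha l m : admissible alpha l m -> lamhat alpha l <> 0.
Proof.
  intros [Hl _]. unfold lamhat, lap, lmin in *. pose proof (pos_INR l).
  destruct (Req_EM_T alpha 0) as [-> | Ha].
  - apply le_INR in Hl. change (INR 1) with 1 in Hl. nra.
  - pose proof (pow2_gt_0 alpha Ha). nra.
Qed.

Lemma admissible_opp alpha l m : admissible alpha l m -> admissible alpha l (- m).
Proof. intros [Hl Hm]; split; lia. Qed.

Lemma admissible_10 alpha : admissible alpha 1 0.
Proof. split; [unfold lmin; destruct (Req_EM_T alpha 0) |]; lia. Qed.

Lemma sgn_opp m : sgn (- m) = sgn m.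
Proof. unfold sgn. now rewrite powerRZ_m1_opp. Qed.

(** Orthonormality of the harmonics for the pairing, which has no conjugation. *)
Lemma pairing_Ylm l m l' m' : (Z.abs m <= Z.of_nat l)%Z ->
  pairing (Ylm l m) (Ylm l' m') = (sgn m * (delta_l l l' * delta_m m (- m')))%C.
Proof.
  intros Hm. unfold delta_l, delta_m.
  destruct (Nat.eqb_spec l l') as [<- | Hl].
  - destruct (Z.eqb_spec m (- m')) as [E | E].
    + replace m' with (- m)%Z by lia. rewrite pairing_Ylm_norm by trivial. fold (sgn m). ring.
    + rewrite pairing_Ylm_order by trivial. ring.
  - rewrite pairing_Ylm_degree by trivial. ring.
Qed.

(** * Structure constants as integrals *)

Lemma pairing_poisson_Ylm alpha G l1 m1 l2 m2 f :
  is_structure_constants alpha G -> admissible alpha l1 m1 -> admissible alpha l2 m2 ->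
      smooth_S2 f ->
  pairing (poisson (Ylm l1 m1) (Ylm l2 m2)) f =
  sum_lm alpha (fun l m => G l1 m1 l2 m2 l m * pairing (Ylm l m) f)%C.
Proof.
  intros HG H1 H2 Hf. destruct (HG _ _ _ _ H1 H2) as [HL E].
  rewrite (pairing_ext _ _ _ _ E (eq_S2_refl f)).
  now apply pairing_sum_lm.
Qed.

Lemma structure_coeff alpha G l1 m1 l2 m2 l m :
  is_structure_constants alpha G -> admissible alpha l1 m1 -> admissible alpha l2 m2 ->
      admissible alpha l m ->
  pairing (poisson (Ylm l1 m1) (Ylm l2 m2)) (Ylm l m) = (sgn m * G l1 m1 l2 m2 l (- m)%Z)%C.
Proof.
  intros HG H1 H2 H.
  rewrite (pairing_poisson_Ylm alpha G) by auto with s3.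
  rewrite (sum_lm_single alpha _ l (- m)).
  - rewrite pairing_Ylm by (rewrite Z.abs_opp; apply H).
    unfold delta_l, delta_m. rewrite Nat.eqb_refl, Z.eqb_refl, sgn_opp. ring.
  - now apply admissible_opp.
  - intros l' m' H' Hne. rewrite pairing_Ylm by apply H'. unfold delta_l, delta_m.
    destruct (Nat.eqb_spec l' l) as [-> | ?]; [| ring].
    destruct (Z.eqb_spec m' (- m)) as [-> | ?]; [exfalso; apply Hne; auto | ring].
Qed.

(** The factor with height = nu Y_{10}. *)
Definition nu : R := sqrt (4 * PI / 3).

Lemma pairing_poisson_height f h : smooth_S2 f -> smooth_S2 h ->
  pairing (poisson height f) h = (RtoC nu * pairing (poisson (Ylm 1 0) f) h)%C.
Proof.
  intros Hf Hh.
  rewrite pairing_poisson by auto with s3.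
  rewrite (pairing_ext _ _ _ _ height_Y10 (eq_S2_refl _)).
  rewrite pairing_scall by auto with s3.
  now rewrite pairing_poisson by auto with s3.
Qed.

Lemma pairing_height_poisson f h : smooth_S2 f -> smooth_S2 h ->
  pairing height (poisson f h) = pairing (poisson height f) h.
Proof. intros. symmetry. apply pairing_poisson; auto with s3. Qed.

(** ({f, g}, h) is invariant under cyclic permutations. *)
Lemma pairing_cycle f g h : smooth_S2 f -> smooth_S2 g -> smooth_S2 h ->
  pairing (poisson g h) f = pairing (poisson f g) h.
Proof. intros. rewrite pairing_sym. symmetry. now apply pairing_poisson. Qed.

Lemma pairing_antisym f g h : smooth_S2 f -> smooth_S2 g -> smooth_S2 h ->
  pairing (poisson f g) h = (- pairing (poisson g f) h)%C.
Proof.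
  intros. transitivity (RtoC (-1) * pairing (poisson g f) h)%C; [| rewrite RtoC_m1; ring].
  rewrite <- pairing_scall by auto with s3. apply pairing_ext; [| apply eq_S2_refl].
  intros t u _. rewrite poisson_antisym, RtoC_m1. ring.
Qed.

(** * The connection *)

(** The inner product of sgrad f and sgrad h. *)
Definition form alpha f h : C := pairing (laplacian_theta alpha f) h.

Lemma form_def alpha f h : form alpha f h = pairing (laplacian_theta alpha f) h.
Proof. reflexivity. Qed.

Lemma smooth_laplacian_theta alpha f : smooth_S2 f -> smooth_S2 (laplacian_theta alpha f).
Proof.
  intros Hf. apply smooth_ext with (fun l u => RtoC (alpha ^ 2) * f l u + RtoC (-1) * laplacian
      f l u)%C;
    [| auto with s3].
  intros l u _. unfold laplacian_theta. rewrite RtoC_m1. ring.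
Qed.
#[local] Hint Resolve smooth_laplacian_theta : s3.

Lemma formE alpha f h : smooth_S2 f -> smooth_S2 h ->
  form alpha f h = (RtoC (alpha ^ 2) * pairing f h - pairing (laplacian f) h)%C.
Proof.
  intros Hf Hh. unfold form.
  transitivity (pairing (fun l u => RtoC (alpha ^ 2) * f l u + RtoC (-1) * laplacian f l u)%C
      h).
  - apply pairing_ext; [| apply eq_S2_refl]. intros l u _. unfold laplacian_theta. rewrite
      RtoC_m1. ring.
  - rewrite pairing_addl, !pairing_scall by auto with s3. rewrite RtoC_m1. ring.
Qed.

Lemma form_sym alpha f h : smooth_S2 f -> smooth_S2 h -> form alpha f h = form alpha h f.
Proof.
  intros. rewrite !formE, pairing_laplacian by trivial.
  rewrite (pairing_sym f h), (pairing_sym f (laplacian h)). reflexivity.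
Qed.

Lemma form_Ylm alpha f l m : smooth_S2 f ->
  form alpha f (Ylm l m) = (RtoC (lamhat alpha l) * pairing f (Ylm l m))%C.
Proof.
  intros Hf. rewrite formE, pairing_laplacian by auto with s3.
  rewrite (pairing_ext f f (laplacian (Ylm l m)) _ (eq_S2_refl f) (laplacian_Ylm l m)).
  rewrite pairing_scalr by auto with s3. unfold lamhat. rewrite RtoC_plus, RtoC_opp. ring.
Qed.

Lemma form_add alpha f f' h : smooth_S2 f -> smooth_S2 f' -> smooth_S2 h ->
  form alpha (fun l u => f l u + f' l u)%C h = (form alpha f h + form alpha f' h)%C.
Proof.
  intros Hf Hf' Hh.
  rewrite (form_sym alpha f h Hf Hh), (form_sym alpha f' h Hf' Hh).
  transitivity (form alpha h (fun l u => f l u + f' l u)%C).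
  - apply form_sym; auto with s3.
  - unfold form. apply pairing_addr; auto with s3.
Qed.

Lemma form_scal alpha (c : C) f h : smooth_S2 f -> smooth_S2 h ->
  form alpha (fun l u => c * f l u)%C h = (c * form alpha f h)%C.
Proof.
  intros Hf Hh.
  rewrite (form_sym alpha f h Hf Hh).
  transitivity (form alpha h (fun l u => c * f l u)%C).
  - apply form_sym; auto with s3.
  - unfold form. apply pairing_scalr; auto with s3.
Qed.

Section Alg.
Variables (alpha : R) (g : ModuleSpace C_Ring) (A : sgrad_algebra alpha g).

(** The element (sgrad f, c) of the central extension. *)
Definition hat_of (f : R -> R -> C) (c : C) : hat g := (sg_sgrad A f, c).

Lemma hat_onto (X : hat g) : exists f c, smooth_S2 f /\ X = hat_of f c.
Proof.
  destruct X as [u c]. destruct (sg_sgrad_onto _ _ A u) as (f & Hf & <-). now exists f, c.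
Qed.

Lemma hat_ip_of f c h d : smooth_S2 f -> smooth_S2 h ->
  hat_ip A (hat_of f c) (hat_of h d) = (form alpha f h + c * d)%C.
Proof. intros. unfold hat_ip, hat_of; cbn [fst snd]. now rewrite sg_ipE. Qed.

Lemma hat_br_of f c h d : smooth_S2 f -> smooth_S2 h ->
  hat_br A (hat_of f c) (hat_of h d) = hat_of (poisson f h) (pairing height (poisson f h)).
Proof. intros. unfold hat_br, hat_of; cbn [fst snd]. now rewrite sg_brE, sg_OmegaE. Qed.

Lemma hat_ip_minus (X Y Z : hat g) : hat_ip A (minus X Y) Z = (hat_ip A X Z - hat_ip A Y Z)%C.
Proof.
  destruct (hat_onto X) as (f & c & Hf & ->), (hat_onto Y) as (h & d & Hh & ->),
    (hat_onto Z) as (k & e & Hk & ->).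
  assert (E : minus (hat_of f c) (hat_of h d) = hat_of (fun l u => f l u + RtoC (-1) * h l u)%C
      (c - d)%C).
  { unfold hat_of. rewrite sg_sgrad_plus, (sg_sgrad_scal alpha g A) by auto with s3.
    change (minus (hat_of f c) (hat_of h d)) with
      (plus (sg_sgrad A f) (opp (sg_sgrad A h)), (c - d)%C).
    apply (f_equal2 pair); [| reflexivity]. apply (f_equal (plus (sg_sgrad A f))).
    rewrite RtoC_m1. symmetry. exact (scal_opp_one (sg_sgrad A h)). }
  rewrite E, !hat_ip_of, form_add, form_scal by auto with s3. rewrite RtoC_m1. ring.
Qed.

Variables (nabla : hat g -> hat g -> hat g) (Hnabla : is_connection A nabla).

(** The Koszul formula, with the cocycle written through brackets with the height. *)
Lemma koszul f a h b k c : smooth_S2 f -> smooth_S2 h -> smooth_S2 k ->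
  (RtoC 2 * hat_ip A (nabla (hat_of f a) (hat_of h b)) (hat_of k c))%C =
  (form alpha (poisson f h) k - form alpha (poisson h k) f + form alpha (poisson k f) h
   + pairing (poisson height f) h * c - pairing (poisson height h) k * a + pairing (poisson
       height k) f * b)%C.
Proof.
  intros Hf Hh Hk. rewrite (proj2 Hnabla).
  rewrite (hat_br_of f a h b), (hat_br_of h b k c), (hat_br_of k c f a) by trivial.
  rewrite (hat_ip_of (poisson f h)) by auto with s3.
  rewrite (hat_ip_of (poisson h k)) by auto with s3.
  rewrite (hat_ip_of (poisson k f)) by auto with s3.
  rewrite (pairing_height_poisson f h) by trivial.
  rewrite (pairing_height_poisson h k) by trivial.
  rewrite (pairing_height_poisson k f) by trivial.
  ring.
Qed.

Variables (G : nat -> Z -> nat -> Z -> nat -> Z -> C) (HG : is_structure_constants alpha G).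

Lemma lamhat_Gamma l1 m1 a1 l2 m2 a2 l m : admissible alpha l m ->
  (RtoC 2 * (RtoC (lamhat alpha l) * Gammacoef alpha G l1 m1 a1 l2 m2 a2 l m) =
   RtoC (lamhat alpha l - lamhat alpha l1 + lamhat alpha l2) * G l1 m1 l2 m2 l m
   - RtoC nu * (RtoC a1 * G 1%nat 0%Z l2 m2 l m + RtoC a2 * G 1%nat 0%Z l1 m1 l m))%C.
Proof.
  intros H. apply lamhat_neq0 in H. pose proof (RtoC_neq _ H) as HC.
  assert (H2 : RtoC 2 <> RtoC 0) by (apply RtoC_neq; lra).
  assert (Ed : RtoC (dcoef alpha l1 l2 l) =
    (RtoC (lamhat alpha l - lamhat alpha l1 + lamhat alpha l2) / (RtoC 2 * RtoC (lamhat alpha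
        l)))%C).
  { rewrite <- RtoC_mult, <- RtoC_div by lra. f_equal. unfold dcoef, lamhat in *. field. lra. }
  unfold Gammacoef, Dcoef. rewrite Ed, RtoC_inv by lra. fold (lamhat alpha l). fold nu.
  field; assumption.
Qed.

(** The covariant derivative of (e_2, a_2) along (e_1, a_1): its central part, and
    the pairings of its Hamiltonian f with the harmonics. *)
Lemma nabla_e_coefficients l1 m1 a1 l2 m2 a2 :
  admissible alpha l1 m1 -> admissible alpha l2 m2 ->
  exists f c, smooth_S2 f /\ nabla (e_hat A l1 m1 a1) (e_hat A l2 m2 a2) = hat_of f c /\
   (RtoC 2 * c = pairing (poisson height (Ylm l1 m1)) (Ylm l2 m2))%C /\
   forall l m, admissible alpha l m ->
     pairing (Ylm l m) f = (sgn m * Gammacoef alpha G l1 m1 a1 l2 m2 a2 l (- m))%C.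
Proof.
  intros H1 H2.
  destruct (hat_onto (nabla (e_hat A l1 m1 a1) (e_hat A l2 m2 a2))) as (f & c & Hf & E).
  exists f, c. repeat split; trivial.
  - (* The Koszul formula is affine in the central part of its last argument;
       comparing the values 1 and 0 there isolates c. *)
    pose proof (koszul (Ylm l1 m1) (RtoC a1) (Ylm l2 m2) (RtoC a2) (Ylm 0 0) (RtoC 1)
      (smooth_Ylm _ _) (smooth_Ylm _ _) (smooth_Ylm _ _)) as K1.
    pose proof (koszul (Ylm l1 m1) (RtoC a1) (Ylm l2 m2) (RtoC a2) (Ylm 0 0) (RtoC 0)
      (smooth_Ylm _ _) (smooth_Ylm _ _) (smooth_Ylm _ _)) as K0.
    change (hat_of (Ylm l1 m1) (RtoC a1)) with (e_hat A l1 m1 a1) in K0, K1.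
    change (hat_of (Ylm l2 m2) (RtoC a2)) with (e_hat A l2 m2 a2) in K0, K1.
    rewrite E, hat_ip_of in K0, K1 by auto with s3.
    match type of K1 with ?x = ?y => match type of K0 with ?z = ?w =>
      transitivity (x - z)%C; [ring | rewrite K1, K0; ring] end end.
  - intros l m H. pose proof (koszul (Ylm l1 m1) (RtoC a1) (Ylm l2 m2) (RtoC a2) (Ylm l m)
      (RtoC 0)
      (smooth_Ylm _ _) (smooth_Ylm _ _) (smooth_Ylm _ _)) as K.
    change (hat_of (Ylm l1 m1) (RtoC a1)) with (e_hat A l1 m1 a1) in K.
    change (hat_of (Ylm l2 m2) (RtoC a2)) with (e_hat A l2 m2 a2) in K.
    rewrite E, hat_ip_of, !form_Ylm in K by auto with s3.
    rewrite (pairing_cycle (Ylm l1 m1) (Ylm l2 m2) (Ylm l m)) in K by auto with s3.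
    rewrite (pairing_cycle (Ylm l2 m2) (Ylm l m) (Ylm l1 m1)), (pairing_cycle (Ylm l1 m1) (Ylm
        l2 m2) (Ylm l m)) in K by auto with s3.
    assert (K2 : pairing (poisson height (Ylm l m)) (Ylm l1 m1) = (- pairing (poisson height
        (Ylm l1 m1)) (Ylm l m))%C).
    { rewrite <- pairing_antisym by auto with s3. apply pairing_cycle; auto with s3. }
    rewrite K2, !pairing_poisson_height, !(structure_coeff alpha G) in K by auto using
        admissible_10 with s3.
    pose proof (lamhat_Gamma l1 m1 a1 l2 m2 a2 l (- m) (admissible_opp _ _ _ H)) as Gm.
    pose proof (RtoC_neq _ (lamhat_neq0 _ _ _ H)) as HC.
    rewrite pairing_sym.
    assert (E2 : (RtoC 2 * RtoC (lamhat alpha l) * (pairing f (Ylm l m) - sgn m * Gammacoef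
        alpha G l1 m1 a1 l2 m2 a2 l (- m)))%C = RtoC 0).
    { transitivity (RtoC 2 * (RtoC (lamhat alpha l) * pairing f (Ylm l m) + c * RtoC 0) -
         sgn m * (RtoC 2 * (RtoC (lamhat alpha l) * Gammacoef alpha G l1 m1 a1 l2 m2 a2 l (-
             m))))%C; [ring |].
      rewrite K, Gm, RtoC_plus, RtoC_minus. ring. }
    apply Cmult_eq0 in E2.
    + transitivity ((pairing f (Ylm l m) - sgn m * Gammacoef alpha G l1 m1 a1 l2 m2 a2 l (- m))
        +
        sgn m * Gammacoef alpha G l1 m1 a1 l2 m2 a2 l (- m))%C; [ring | rewrite E2; ring].
    + apply Cmult_neq_0; [apply RtoC_neq; lra | exact HC].
Qed.

End Alg.

Local Opaque form laplacian_theta.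

(** * The curvature *)

Lemma fin_supp_G alpha G l1 m1 l2 m2 : is_structure_constants alpha G ->
  admissible alpha l1 m1 -> admissible alpha l2 m2 -> fin_supp alpha (G l1 m1 l2 m2).
Proof. intros HG H1 H2. exact (proj1 (HG _ _ _ _ H1 H2)). Qed.

Lemma fin_supp_Gamma alpha G l1 m1 a1 l2 m2 a2 : is_structure_constants alpha G ->
  admissible alpha l1 m1 -> admissible alpha l2 m2 -> fin_supp alpha (Gammacoef alpha G l1 m1
      a1 l2 m2 a2).
Proof.
  intros HG H1 H2.
  destruct (HG _ _ _ _ H1 H2) as [[L E] _].
  destruct (HG _ _ _ _ (admissible_10 alpha) H1) as [[L1 E1] _].
  destruct (HG _ _ _ _ (admissible_10 alpha) H2) as [[L2 E2] _].
  exists (L + L1 + L2)%nat. intros l m H Hl.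
  pose proof (RtoC_neq _ (lamhat_neq0 _ _ _ H)) as HC.
  unfold Gammacoef, Dcoef. fold (lamhat alpha l). rewrite E, E1, E2 by (trivial; lia).
  field. exact HC.
Qed.

Lemma form_pairing alpha f h : smooth_S2 f -> smooth_S2 h ->
  form alpha h f = pairing h (laplacian_theta alpha f).
Proof.
  intros Hf Hh. rewrite (form_sym alpha h f Hh Hf). rewrite form_def. apply pairing_sym.
Qed.

Lemma pairing_height_swap f h : smooth_S2 f -> smooth_S2 h ->
  pairing (poisson height h) f = (- pairing (poisson height f) h)%C.
Proof.
  intros Hf Hh. rewrite <- pairing_antisym by auto with s3.
  apply pairing_cycle; auto with s3.
Qed.

(** The component along (e_2, a_2) of the derivative along (e_1, a_1) of an
    arbitrary element (sgrad f, c): it depends on f only through its pairings with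
    the harmonics. *)
Lemma hat_ip_nabla_e alpha (g : ModuleSpace C_Ring) (A : sgrad_algebra alpha g)
  (nabla : hat g -> hat g -> hat g) (Hnabla : is_connection A nabla)
  (G : nat -> Z -> nat -> Z -> nat -> Z -> C) (HG : is_structure_constants alpha G)
  l1 m1 a1 l2 m2 a2 f c :
  admissible alpha l1 m1 -> admissible alpha l2 m2 -> smooth_S2 f ->
  (RtoC 2 * hat_ip A (nabla (e_hat A l1 m1 a1) (hat_of alpha g A f c)) (e_hat A l2 m2 a2))%C =
  (- (RtoC 2 * sum_lm alpha (fun l m => RtoC (lamhat alpha l) * Gammacoef alpha G l1 m1 a1 l2
      m2 a2 l m
         * pairing (Ylm l m) f))
   - c * pairing (poisson height (Ylm l1 m1)) (Ylm l2 m2))%C.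
Proof.
  intros H1 H2 Hf.
  pose proof (smooth_Ylm l1 m1) as S1. pose proof (smooth_Ylm l2 m2) as S2.
  pose proof (koszul alpha g A nabla Hnabla (Ylm l1 m1) (RtoC a1) f c (Ylm l2 m2) (RtoC a2) S1
      Hf S2) as K.
  change (hat_of alpha g A (Ylm l1 m1) (RtoC a1)) with (e_hat A l1 m1 a1) in K.
  change (hat_of alpha g A (Ylm l2 m2) (RtoC a2)) with (e_hat A l2 m2 a2) in K.
  rewrite K. clear K.
  set (q := pairing (poisson (Ylm l1 m1) (Ylm l2 m2)) f).
  assert (E1 : pairing (poisson (Ylm l1 m1) f) (Ylm l2 m2) = (- q)%C).
  { rewrite (pairing_cycle (Ylm l2 m2) (Ylm l1 m1) f) by trivial. now apply pairing_antisym. }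
  assert (E2 : pairing (poisson f (Ylm l2 m2)) (Ylm l1 m1) = (- q)%C).
  { rewrite (pairing_cycle (Ylm l1 m1) f (Ylm l2 m2)) by trivial. exact E1. }
  rewrite (form_Ylm alpha (poisson (Ylm l1 m1) f) l2 m2) by auto with s3.
  rewrite (form_Ylm alpha (poisson f (Ylm l2 m2)) l1 m1) by auto with s3.
  rewrite E1, E2.
  rewrite (form_pairing alpha f (poisson (Ylm l2 m2) (Ylm l1 m1))) by auto with s3.
  rewrite (pairing_antisym (Ylm l2 m2) (Ylm l1 m1) (laplacian_theta alpha f)) by auto with s3.
  rewrite (pairing_height_swap (Ylm l2 m2) f) by trivial.
  rewrite (pairing_height_swap (Ylm l1 m1) (Ylm l2 m2)) by trivial.
  rewrite (pairing_poisson_height (Ylm l1 m1) f) by trivial.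
  rewrite (pairing_poisson_height (Ylm l2 m2) f) by trivial.
  unfold q.
  rewrite (pairing_poisson_Ylm alpha G l1 m1 l2 m2 f) by trivial.
  rewrite (pairing_poisson_Ylm alpha G l1 m1 l2 m2 (laplacian_theta alpha f)) by auto with s3.
  rewrite (pairing_poisson_Ylm alpha G 1 0 l1 m1 f) by auto using admissible_10.
  rewrite (pairing_poisson_Ylm alpha G 1 0 l2 m2 f) by auto using admissible_10.
  set (p := fun l m => pairing (Ylm l m) f).
  rewrite (sum_lm_ext alpha (fun l m => G l1 m1 l2 m2 l m * pairing (Ylm l m) (laplacian_theta
      alpha f))%C
     (fun l m => RtoC (lamhat alpha l) * (G l1 m1 l2 m2 l m * p l m))%C).
  2:{ intros l m _. rewrite pairing_sym. rewrite <- form_def. rewrite form_Ylm by trivial.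
      rewrite pairing_sym. unfold p. ring. }
  assert (F0 : fin_supp alpha (fun l m => G l1 m1 l2 m2 l m * p l m)%C).
  { apply fin_supp_mulr, fin_supp_G; trivial. }
  assert (F1 : fin_supp alpha (fun l m => G 1%nat 0%Z l1 m1 l m * p l m)%C).
  { apply fin_supp_mulr, fin_supp_G; auto using admissible_10. }
  assert (F2 : fin_supp alpha (fun l m => G 1%nat 0%Z l2 m2 l m * p l m)%C).
  { apply fin_supp_mulr, fin_supp_G; auto using admissible_10. }
  assert (FG : fin_supp alpha (fun l m => RtoC (lamhat alpha l) * Gammacoef alpha G l1 m1 a1 l2
      m2 a2 l m * p l m)%C).
  { apply fin_supp_mulr. apply fin_supp_mull. now apply fin_supp_Gamma. }
  change (fun l m => RtoC (lamhat alpha l) * Gammacoef alpha G l1 m1 a1 l2 m2 a2 l m * pairing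
      (Ylm l m) f)%C
    with (fun l m => RtoC (lamhat alpha l) * Gammacoef alpha G l1 m1 a1 l2 m2 a2 l m * p l m)%C.
  rewrite <- (sum_lm_scal alpha (RtoC 2)) by trivial.
  rewrite (sum_lm_ext alpha (fun l m => RtoC 2 * (RtoC (lamhat alpha l) * Gammacoef alpha G l1
      m1 a1 l2 m2 a2 l m * p l m))%C
    (fun l m => (RtoC (lamhat alpha l) * (G l1 m1 l2 m2 l m * p l m)
        + RtoC (lamhat alpha l2 - lamhat alpha l1) * (G l1 m1 l2 m2 l m * p l m))
        + (RtoC (- nu * a1) * (G 1%nat 0%Z l2 m2 l m * p l m) + RtoC (- nu * a2) * (G 1%nat 0%Z
            l1 m1 l m * p l m)))%C).
  2:{ intros l m H. pose proof (lamhat_Gamma alpha G l1 m1 a1 l2 m2 a2 l m H) as Gm.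
      transitivity (RtoC 2 * (RtoC (lamhat alpha l) * Gammacoef alpha G l1 m1 a1 l2 m2 a2 l m)
          * p l m)%C; [ring |].
      rewrite Gm, !RtoC_mult, !RtoC_plus, !RtoC_minus, RtoC_opp. ring. }
  rewrite sum_lm_linear by first [assumption | now apply fin_supp_mull].
  rewrite !RtoC_mult, !RtoC_minus, RtoC_opp. unfold p. ring.
Qed.

Lemma kcoef_lamhat alpha l3 l4 l : lamhat alpha l <> 0 ->
  2 * (lamhat alpha l * kcoef alpha l3 l4 l) = lamhat alpha l - lamhat alpha l3 - lamhat alpha
      l4.
Proof. intros H. unfold kcoef, lamhat in *. field. exact H. Qed.

Lemma Dcoef_lamhat alpha G l2 m2 l m : lamhat alpha l <> 0 ->
  (RtoC (lamhat alpha l) * Dcoef alpha G l2 m2 l m)%C = (RtoC nu * G 1%nat 0%Z l2 m2 l m)%C.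
Proof.
  intros H. unfold Dcoef. fold nu. fold (lamhat alpha l). field. now apply RtoC_neq.
Qed.

(** The component along (e_4, a_4) of the derivative of (e_3, a_3) along the
    bracket of (e_1, a_1) and (e_2, a_2). *)
Lemma hat_ip_nabla_br alpha (g : ModuleSpace C_Ring) (A : sgrad_algebra alpha g)
  (nabla : hat g -> hat g -> hat g) (Hnabla : is_connection A nabla)
  (G : nat -> Z -> nat -> Z -> nat -> Z -> C) (HG : is_structure_constants alpha G)
  l1 m1 a1 l2 m2 a2 l3 m3 a3 l4 m4 a4 :
  admissible alpha l1 m1 -> admissible alpha l2 m2 ->
  admissible alpha l3 m3 -> admissible alpha l4 m4 ->
  (RtoC 2 * hat_ip A (nabla (hat_br A (e_hat A l1 m1 a1) (e_hat A l2 m2 a2)) (e_hat A l3 m3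
      a3)) (e_hat A l4 m4 a4))%C =
  (- (RtoC 2 * sum_lm alpha (fun l m => sgn m * RtoC (lamhat alpha l) * (G l1 m1 l2 m2 l m *
        (G l3 m3 l4 m4 l (- m)%Z * RtoC (kcoef alpha l3 l4 l)
         + RtoC (/ 2) * (RtoC a4 * Dcoef alpha G l3 m3 l (- m)
                         - RtoC a3 * Dcoef alpha G l4 m4 l (- m))))))
   - pairing (poisson height (Ylm l1 m1)) (Ylm l2 m2) * pairing (poisson height (Ylm l3 m3))
       (Ylm l4 m4))%C.
Proof.
  intros H1 H2 H3 H4.
  set (g0 := G l1 m1 l2 m2).
  assert (F0 : forall K, fin_supp alpha (fun l m => g0 l m * K l m)%C).
  { intros K. now apply fin_supp_mulr, fin_supp_G. }
  assert (ES : (RtoC 2 * sum_lm alpha (fun l m => sgn m * RtoC (lamhat alpha l) * (g0 l m *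
        (G l3 m3 l4 m4 l (- m)%Z * RtoC (kcoef alpha l3 l4 l)
         + RtoC (/ 2) * (RtoC a4 * Dcoef alpha G l3 m3 l (- m)
                         - RtoC a3 * Dcoef alpha G l4 m4 l (- m))))))%C =
    ((sum_lm alpha (fun l m => g0 l m * (RtoC (lamhat alpha l) * (sgn m * G l3 m3 l4 m4 l (-
        m)%Z)))
      + RtoC (- lamhat alpha l3 - lamhat alpha l4) *
          sum_lm alpha (fun l m => g0 l m * (sgn m * G l3 m3 l4 m4 l (- m)%Z)))
     + (RtoC a4 * sum_lm alpha (fun l m => g0 l m * (RtoC nu * (sgn m * G 1%nat 0%Z l3 m3 l (-
         m)%Z)))
        + RtoC (- a3) * sum_lm alpha (fun l m => g0 l m * (RtoC nu * (sgn m * G 1%nat 0%Z l4 m4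
            l (- m)%Z)))))%C).
  { rewrite <- sum_lm_scal, <- sum_lm_linear by first [apply F0 | apply fin_supp_mull, F0].
    apply sum_lm_ext. intros l m H. pose proof (lamhat_neq0 _ _ _ H) as HL.
    pose proof (kcoef_lamhat alpha l3 l4 l HL) as Ek.
    pose proof (Dcoef_lamhat alpha G l3 m3 l (- m) HL) as D3.
    pose proof (Dcoef_lamhat alpha G l4 m4 l (- m) HL) as D4.
    assert (H2' : (RtoC 2 * RtoC (/ 2))%C = RtoC 1) by (rewrite <- RtoC_mult; f_equal; field).
    transitivity (sgn m * g0 l m * (G l3 m3 l4 m4 l (- m)%Z * RtoC (2 * (lamhat alpha l * kcoef
        alpha l3 l4 l))
       + (RtoC 2 * RtoC (/ 2)) * (RtoC a4 * (RtoC (lamhat alpha l) * Dcoef alpha G l3 m3 l (-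
           m))
          - RtoC a3 * (RtoC (lamhat alpha l) * Dcoef alpha G l4 m4 l (- m)))))%C.
    { rewrite !RtoC_mult. ring. }
    rewrite Ek, D3, D4, H2', !RtoC_minus, !RtoC_opp. ring. }
  rewrite ES, RtoC_minus, !RtoC_opp. clear ES.
  pose proof (smooth_Ylm l1 m1) as S1. pose proof (smooth_Ylm l2 m2) as S2.
  pose proof (smooth_Ylm l3 m3) as S3. pose proof (smooth_Ylm l4 m4) as S4.
  set (h := poisson (Ylm l1 m1) (Ylm l2 m2)).
  assert (Hh : smooth_S2 h) by (unfold h; auto with s3).
  change (e_hat A l1 m1 a1) with (hat_of alpha g A (Ylm l1 m1) (RtoC a1)).
  change (e_hat A l2 m2 a2) with (hat_of alpha g A (Ylm l2 m2) (RtoC a2)).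
  change (e_hat A l3 m3 a3) with (hat_of alpha g A (Ylm l3 m3) (RtoC a3)).
  change (e_hat A l4 m4 a4) with (hat_of alpha g A (Ylm l4 m4) (RtoC a4)).
  rewrite (hat_br_of alpha g A (Ylm l1 m1) (RtoC a1) (Ylm l2 m2) (RtoC a2) S1 S2).
  rewrite (pairing_height_poisson (Ylm l1 m1) (Ylm l2 m2) S1 S2).
  fold h.
  rewrite (koszul alpha g A nabla Hnabla h _ (Ylm l3 m3) (RtoC a3) (Ylm l4 m4) (RtoC a4) Hh S3
      S4).
  set (k := poisson (Ylm l3 m3) (Ylm l4 m4)).
  assert (Hk : smooth_S2 k) by (unfold k; auto with s3).
  assert (E1 : pairing (poisson h (Ylm l3 m3)) (Ylm l4 m4) = pairing h k).
  { rewrite <- (pairing_cycle h (Ylm l3 m3) (Ylm l4 m4)) by trivial. apply pairing_sym. }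
  assert (E2 : pairing (poisson (Ylm l4 m4) h) (Ylm l3 m3) = pairing h k).
  { rewrite (pairing_cycle (Ylm l3 m3) (Ylm l4 m4) h) by trivial. apply pairing_sym. }
  rewrite (form_Ylm alpha (poisson h (Ylm l3 m3)) l4 m4) by auto with s3.
  rewrite (form_Ylm alpha (poisson (Ylm l4 m4) h) l3 m3) by auto with s3.
  rewrite E1, E2.
  rewrite form_def, (pairing_sym (laplacian_theta alpha k) h).
  rewrite (pairing_height_swap (Ylm l3 m3) h) by trivial.
  rewrite (pairing_sym (poisson height (Ylm l3 m3)) h), (pairing_sym (poisson height (Ylm l4
      m4)) h).
  assert (P : forall f, smooth_S2 f -> pairing h f = sum_lm alpha (fun l m => G l1 m1 l2 m2 l m
      * pairing (Ylm l m) f)%C).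
  { intros f Hf. now apply pairing_poisson_Ylm. }
  rewrite (P k), (P (laplacian_theta alpha k)), (P (poisson height (Ylm l3 m3))),
    (P (poisson height (Ylm l4 m4))) by auto with s3.
  fold g0.
  assert (X1 : sum_lm alpha (fun l m => g0 l m * pairing (Ylm l m) k)%C =
     sum_lm alpha (fun l m => g0 l m * (sgn m * G l3 m3 l4 m4 l (- m)%Z))%C).
  { apply sum_lm_ext. intros l m H. f_equal. rewrite pairing_sym. now apply (structure_coeff
      alpha). }
  assert (X2 : sum_lm alpha (fun l m => g0 l m * pairing (Ylm l m) (laplacian_theta alpha k))%C
      =
     sum_lm alpha (fun l m => g0 l m * (RtoC (lamhat alpha l) * (sgn m * G l3 m3 l4 m4 l (-
         m)%Z)))%C).
  { apply sum_lm_ext. intros l m H. f_equal. rewrite pairing_sym.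
    rewrite <- form_def. rewrite form_Ylm by trivial. f_equal. now apply (structure_coeff
        alpha). }
  assert (X3 : forall l' m', admissible alpha l' m' ->
     sum_lm alpha (fun l m => g0 l m * pairing (Ylm l m) (poisson height (Ylm l' m')))%C =
     sum_lm alpha (fun l m => g0 l m * (RtoC nu * (sgn m * G 1%nat 0%Z l' m' l (- m)%Z)))%C).
  { intros l' m' H'. apply sum_lm_ext. intros l m H. f_equal. rewrite pairing_sym.
    rewrite pairing_poisson_height by auto with s3. f_equal.
    apply (structure_coeff alpha); auto using admissible_10. }
  rewrite X1, X2, (X3 l3 m3 H3), (X3 l4 m4 H4).
  ring.
Qed.

(** The value of the cocycle on two harmonics. *)
Lemma pairing_height_Ylm l1 m1 l2 m2 : (Z.abs m1 <= Z.of_nat l1)%Z ->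
  pairing (poisson height (Ylm l1 m1)) (Ylm l2 m2) =
  (- (RtoC (IZR m1) * Ci) * (sgn m1 * (delta_l l1 l2 * delta_m m1 (- m2))))%C.
Proof.
  intros H. rewrite (pairing_ext _ _ _ _ (poisson_height_Ylm l1 m1) (eq_S2_refl _)).
  rewrite pairing_scall by auto with s3. now rewrite pairing_Ylm.
Qed.

Lemma sgn_add m n : sgn (m + n) = (sgn m * sgn n)%C.
Proof. unfold sgn. rewrite powerRZ_add by lra. apply RtoC_mult. Qed.

Theorem theorem3p7
  (alpha : R) (g : ModuleSpace C_Ring) (A : sgrad_algebra alpha g)
  (nabla : hat g -> hat g -> hat g) (Hnabla : is_connection A nabla)
  (G : nat -> Z -> nat -> Z -> nat -> Z -> C)
  (HG : is_structure_constants alpha G)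
  (l1 l2 l3 l4 : nat) (m1 m2 m3 m4 : Z) (a1 a2 a3 a4 : R)
  (H1 : admissible alpha l1 m1) (H2 : admissible alpha l2 m2)
  (H3 : admissible alpha l3 m3) (H4 : admissible alpha l4 m4) :
  hat_ip A
    (hat_curvature A nabla (e_hat A l1 m1 a1) (e_hat A l2 m2 a2) (e_hat A l3 m3 a3))
    (e_hat A l4 m4 a4)
  =
  (sum_lm alpha (fun l m =>
     sgn m * RtoC (alpha ^ 2 + lap l) *
     (Gammacoef alpha G l1 m1 a1 l3 m3 a3 l m * Gammacoef alpha G l2 m2 a2 l4 m4 a4 l (- m)
      - Gammacoef alpha G l2 m2 a2 l3 m3 a3 l m * Gammacoef alpha G l1 m1 a1 l4 m4 a4 l (- m)
      + G l1 m1 l2 m2 l m *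
        (G l3 m3 l4 m4 l (- m)%Z * RtoC (kcoef alpha l3 l4 l)
         + RtoC (/ 2) * (RtoC a4 * Dcoef alpha G l3 m3 l (- m)
                         - RtoC a3 * Dcoef alpha G l4 m4 l (- m)))))
   - RtoC (IZR m1 * IZR m2 / 4) * sgn (m1 + m2) *
     (delta_l l1 l3 * delta_m m1 (- m3) * delta_l l2 l4 * delta_m m2 (- m4)
      - delta_l l2 l3 * delta_m m2 (- m3) * delta_l l1 l4 * delta_m m1 (- m4))
   - RtoC (IZR m1 * IZR m3 / 2) * sgn (m1 + m3) *
     (delta_l l1 l2 * delta_m m1 (- m2) * delta_l l3 l4 * delta_m m3 (- m4)))%C.
Proof.
  unfold hat_curvature. rewrite !hat_ip_minus.
  (* Both iterated derivatives, for (i, j) = (1, 2) and (2, 1); the sum is reindexed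
     by m -> -m. *)
  assert (T : forall li mi ai lj mj aj, admissible alpha li mi -> admissible alpha lj mj ->
    (RtoC 2 * hat_ip A (nabla (e_hat A li mi ai) (nabla (e_hat A lj mj aj) (e_hat A l3 m3 a3)))
        (e_hat A l4 m4 a4) =
    - (RtoC 2 * sum_lm alpha (fun l m => sgn m * RtoC (lamhat alpha l) *
         (Gammacoef alpha G lj mj aj l3 m3 a3 l m * Gammacoef alpha G li mi ai l4 m4 a4 l (-
             m))))
    - RtoC (/ 2) * (pairing (poisson height (Ylm lj mj)) (Ylm l3 m3) * pairing (poisson height
        (Ylm li mi)) (Ylm l4 m4)))%C).
  { intros li mi ai lj mj aj Hi Hj.
    destruct (nabla_e_coefficients alpha g A nabla Hnabla G HG lj mj aj l3 m3 a3 Hj H3) as (f &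
        c & Hf & E & Ec & Ef).
    set (F := fun l m => (sgn m * RtoC (lamhat alpha l) *
      (Gammacoef alpha G lj mj aj l3 m3 a3 l m * Gammacoef alpha G li mi ai l4 m4 a4 l (-
          m)))%C).
    assert (ES : sum_lm alpha (fun l m => RtoC (lamhat alpha l) * Gammacoef alpha G li mi ai l4
        m4 a4 l m
       * pairing (Ylm l m) f)%C = sum_lm alpha F).
    { transitivity (sum_lm alpha (fun l m => F l (- m)%Z)); [| apply sum_lm_opp_order].
      apply sum_lm_ext. intros l m H. unfold F.
      rewrite (Ef l m H), sgn_opp, Z.opp_involutive. ring. }
    rewrite E, (hat_ip_nabla_e alpha g A nabla Hnabla G HG li mi ai l4 m4 a4 f c Hi H4 Hf), ES.
    rewrite <- Ec, RtoC_inv by lra. field. }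
  pose proof (T l1 m1 a1 l2 m2 a2 H1 H2) as T1.
  pose proof (T l2 m2 a2 l1 m1 a1 H2 H1) as T2.
  pose proof (hat_ip_nabla_br alpha g A nabla Hnabla G HG l1 m1 a1 l2 m2 a2 l3 m3 a3 l4 m4 a4
      H1 H2 H3 H4) as T3.
  clear T.
  rewrite !pairing_height_Ylm in T1, T2, T3 by (apply H1 || apply H2 || apply H3).
  assert (F : forall li mi ai (K : nat -> Z -> C), admissible alpha li mi ->
    fin_supp alpha (fun l m => sgn m * RtoC (lamhat alpha l) * (Gammacoef alpha G li mi ai l3
        m3 a3 l m * K l m))%C).
  { intros. apply fin_supp_mull, fin_supp_mulr. now apply fin_supp_Gamma. }
  rewrite (sum_lm_ext alpha _ (fun l m =>
     (sgn m * RtoC (lamhat alpha l) *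
         (Gammacoef alpha G l1 m1 a1 l3 m3 a3 l m * Gammacoef alpha G l2 m2 a2 l4 m4 a4 l (-
             m)))
     + ((RtoC (-1) * (sgn m * RtoC (lamhat alpha l) *
         (Gammacoef alpha G l2 m2 a2 l3 m3 a3 l m * Gammacoef alpha G l1 m1 a1 l4 m4 a4 l (-
             m))))
       + (sgn m * RtoC (lamhat alpha l) * (G l1 m1 l2 m2 l m *
        (G l3 m3 l4 m4 l (- m)%Z * RtoC (kcoef alpha l3 l4 l)
         + RtoC (/ 2) * (RtoC a4 * Dcoef alpha G l3 m3 l (- m)
                         - RtoC a3 * Dcoef alpha G l4 m4 l (- m)))))))%C).
  2:{ intros l m _. unfold lamhat. rewrite RtoC_m1. ring. }
  assert (FG : fin_supp alpha (fun l m => sgn m * RtoC (lamhat alpha l) * (G l1 m1 l2 m2 l m *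
        (G l3 m3 l4 m4 l (- m)%Z * RtoC (kcoef alpha l3 l4 l)
         + RtoC (/ 2) * (RtoC a4 * Dcoef alpha G l3 m3 l (- m)
                         - RtoC a3 * Dcoef alpha G l4 m4 l (- m)))))%C).
  { apply fin_supp_mull, fin_supp_mulr. now apply fin_supp_G. }
  rewrite sum_lm_add; [| now apply F | apply fin_supp_add; [apply fin_supp_mull; now apply F |
      exact FG]].
  rewrite sum_lm_add; [| apply fin_supp_mull; now apply F | exact FG].
  rewrite sum_lm_scal by now apply F.
  match type of T1 with (_ * ?x = - (_ * ?s) - _)%C => set (X1 := x) in *; set (SA := s) in *
      end.
  match type of T2 with (_ * ?x = - (_ * ?s) - _)%C => set (X2 := x) in *; set (SB := s) in *
      end.
  match type of T3 with (_ * ?x = - (_ * ?s) - _)%C => set (X3 := x) in *; set (SC := s) in *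
      end.
  assert (HC : RtoC 2 <> RtoC 0) by (apply RtoC_neq; lra).
  assert (D : forall x y : C, (RtoC 2 * x)%C = y -> x = (y / RtoC 2)%C) by (intros x y <-;
      field).
  rewrite (D _ _ T1), (D _ _ T2), (D _ _ T3).
  assert (I2 : (Ci * Ci)%C = (- RtoC 1)%C).
  { unfold Ci, Cmult, Copp, RtoC; cbn [fst snd]. f_equal; ring. }
  rewrite !sgn_add, RtoC_m1.
  assert (R4 : forall x y, RtoC (x * y / 4) = (RtoC x * RtoC y / (RtoC 2 * RtoC 2))%C).
  { intros. rewrite <- !RtoC_mult, <- RtoC_div by lra. apply (f_equal RtoC). field. }
  assert (R2 : forall x y, RtoC (x * y / 2) = (RtoC x * RtoC y / RtoC 2)%C).
  { intros. rewrite <- !RtoC_mult, <- RtoC_div by lra. reflexivity. }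
  rewrite R4, R2, RtoC_inv by lra.
  field [I2].
Qed.
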